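(* Let $\mathcal{C}$ be a class of groups closed under taking subgroups, quotients, and such that in any group the product of finitely many normal $\mathcal{C}$-subgroups is again a $\mathcal{C}$-subgroup. Let $w$ be a multilinear commutator word, and let $G$ be a profinite group. Then the verbal subgroup $w(G)$ is virtually-$\mathcal{C}$ if and only if the set of all $w$-values in $G$ is contained in a union of countably many cosets $t_iG_i$ of subgroups $G_i$ of $G$, where each $G_i$ is in $\mathcal{C}$.
   Context: In the context of profinite groups all usual group-theoretic concepts are interpreted topologically: ''subgroup'' means closed subgroup, and the subgroup generated by a set means the closed subgroup topologically generated by it. Commutators are $[x,y]=x^{-1}y^{-1}xy$. Multilinear commutators are group-words defined recursively: the word $w(x)=x$ in one variable is a multilinear commutator; if $u$ and $v$ are multilinear commutators involving disjoint sets of variables, then $w=[u,v]$ is a multilinear commutator; all multilinear commutators arise in this way. For a group-word $w=w(x_1,\dots,x_n)$, the $w$-values in $G$ are the elements $w(g_1,\dots,g_n)$ with $g_i\in G$, and $w(G)$ is the (closed) subgroup generated by all $w$-values. A $\mathcal{C}$-subgroup is a subgroup belonging to $\mathcal{C}$. A group is virtually-$\mathcal{C}$ if it has a normal subgroup of finite index that belongs to $\mathcal{C}$. ''Countably many'' means finitely many or countably infinitely many. *)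

(* Defs.v *)
From HB Require Import structures.
From mathcomp Require Import all_boot all_classical topology.

Set Implicit Arguments.
Unset Strict Implicit.
Unset Printing Implicit Defensive.

Local Open Scope classical_set_scope.
Local Open Scope group_scope.

HB.mixin Record isTopologicalGroup G of Group G & Topological G := {
  mulg_continuous : continuous (fun p : G * G => p.1 * p.2);
  invg_continuous : continuous (fun x : G => x^-1)
}.

#[short(type="topologicalGroupType")]
HB.structure Definition TopologicalGroup :=
  {G of Group G & Topological G & isTopologicalGroup G}.

HB.mixin Record isProfinite G of TopologicalGroup G := {
  profinite_hausdorff : hausdorff_space G;
  profinite_compact : compact [set: G];
  profinite_totally_disconnected : totally_disconnected [set: G]
}.

#[short(type="profiniteGroupType")]
HB.structure Definition ProfiniteGroup :=
  {G of TopologicalGroup G & isProfinite G}.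

Record is_closed_subgroup (G : topologicalGroupType) (A : set G) : Prop :=
  IsClosedSubgroup {
    closed_subgroup_closed : closed A;
    closed_subgroup1 : A 1;
    closed_subgroupM : forall x y, A x -> A y -> A (x * y);
    closed_subgroupV : forall x, A x -> A x^-1
  }.

Record closedSubgroup (G : topologicalGroupType) := ClosedSubgroup {
  subgroup_set :> set G;
  subgroupP : is_closed_subgroup subgroup_set
}.

(** A closed subgroup of a profinite group is itself a profinite group: its
    carrier is the subtype [set_type H], with the subspace topology that the
    library puts on it and the induced group structure. *)
Definition subgroup_type (G : topologicalGroupType) (H : closedSubgroup G) :=
  set_type H.

Section SubgroupType.
Variables (G : topologicalGroupType) (H : closedSubgroup G).

HB.instance Definition _ := Topological.on (subgroup_type H).
HB.instance Definition _ := SubChoice.on (subgroup_type H).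

Lemma subgroup_group_closed :
  group_closed ((fun x : G => x \in (H : set G)) : {pred G}).
Proof.
split=> [|x y]; rewrite !unfold_in.
  by apply/mem_set; exact: closed_subgroup1 (subgroupP H).
move=> /set_mem Hx /set_mem Hy; apply/mem_set.
apply: (closed_subgroupM (subgroupP H)) => //.
exact: (closed_subgroupV (subgroupP H)).
Qed.

HB.instance Definition _ :=
  SubChoice_isSubGroup.Build G _ (subgroup_type H) subgroup_group_closed.

Lemma subgroup_val_continuous : continuous (val : subgroup_type H -> G).
Proof. exact: (@initial_continuous (subgroup_type H) G val). Qed.

Lemma continuous_into_subgroup (X : topologicalType) (f : X -> subgroup_type H) :
  continuous (val \o f) -> continuous f.
Proof. by move=> cf; apply: continuous_comp_initial. Qed.

Lemma subgroup_mulg_continuous :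
  continuous (fun p : subgroup_type H * subgroup_type H => p.1 * p.2).
Proof.
apply: continuous_into_subgroup => p.
rewrite (_ : val \o _ =
  (fun q : G * G => q.1 * q.2) \o (fun p => (val p.1, val p.2))) //.
apply: continuous_comp; last exact: mulg_continuous.
by apply: cvg_pair; apply: continuous_comp;
  [exact: cvg_fst|exact: subgroup_val_continuous
  |exact: cvg_snd|exact: subgroup_val_continuous].
Qed.

Lemma subgroup_invg_continuous : continuous (fun x : subgroup_type H => x^-1).
Proof.
apply: continuous_into_subgroup => x.
rewrite (_ : val \o _ = (fun y : G => y^-1) \o val) //.
by apply: continuous_comp;
  [exact: subgroup_val_continuous|exact: invg_continuous].
Qed.

HB.instance Definition _ := isTopologicalGroup.Build (subgroup_type H)
  subgroup_mulg_continuous subgroup_invg_continuous.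

End SubgroupType.

Section ProfiniteSubgroup.
Variables (G : profiniteGroupType) (H : closedSubgroup G).
Notation S := (subgroup_type H).

Lemma subgroup_hausdorff : hausdorff_space S.
Proof.
move=> x y clxy; apply: val_inj; apply: (@profinite_hausdorff G) => A B nA nB.
have [z [Az Bz]] := clxy _ _ (subgroup_val_continuous nA)
  (subgroup_val_continuous nB).
by exists (val z).
Qed.

Lemma subgroup_compact : compact [set: S].
Proof.
move=> F FF _.
have cH : compact (H : set G).
  apply: (subclosed_compact _ profinite_compact) => //.
  exact: closed_subgroup_closed (subgroupP H).
have FH : (fmap (val : S -> G) F) (H : set G).
  rewrite /fmap /= (_ : _ @^-1` _ = setT); first exact: filterT.
  by apply/seteqP; split=> // z _; exact: set_valP.
have [p [Hp clp]] := cH _ (fmap_proper_filter val FF) FH.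
exists (exist _ p (mem_set Hp)); split=> // A B FA.
rewrite nbhsE /= => -[_ [[V oV <-] Vp] VB].
have nV : nbhs p V by exact: open_nbhs_nbhs.
have FvA : fmap (val : S -> G) F (val @` A).
  by apply: (@filterS _ F _ A) => // z Az; exists z.
have [_ [[z Az <-] Vz]] := clp _ _ FvA nV.
by exists z; split=> //; exact: VB.
Qed.

Lemma subgroup_totally_disconnected : totally_disconnected [set: S].
Proof.
move=> x _; rewrite eqEsubset; split=> [y [A [Ax _ cA] Ay]|_ ->]; last first.
  exact: connected_component_refl.
apply: val_inj.
have : connected_component [set: G] (val x) (val y).
  exists (val @` A); last by exists y.
  split; [by exists x|by []|].
  apply: connected_continuous_connected => //.
  exact/continuous_subspaceT/subgroup_val_continuous.
by rewrite profinite_totally_disconnected.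
Qed.

HB.instance Definition _ := isProfinite.Build S
  subgroup_hausdorff subgroup_compact subgroup_totally_disconnected.

End ProfiniteSubgroup.

Definition subgroup_profinite (G : profiniteGroupType) (H : closedSubgroup G) :
  profiniteGroupType := subgroup_type H.

Lemma smallest_is_closed_subgroup (G : topologicalGroupType) (X : set G) :
  is_closed_subgroup (smallest (@is_closed_subgroup G) X).
Proof.
split.
- by apply: closed_bigI => A [[]].
- by move=> A [[]].
- by move=> x y Xx Xy A XA; case: (XA) => -[_ _ AM _] _; apply: AM;
    [exact: Xx|exact: Xy].
- by move=> x Xx A XA; case: (XA) => -[_ _ _ AV] _; apply: AV; exact: Xx.
Qed.

Definition closed_generated (G : topologicalGroupType) (X : set G) :
  closedSubgroup G := ClosedSubgroup (smallest_is_closed_subgroup X).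

Definition lcoset (G : topologicalGroupType) (t : G) (A : set G) : set G :=
  [set t * x | x in A].

Definition normal_subgroup (G : topologicalGroupType) (N : closedSubgroup G) :=
  forall g x : G, subgroup_set N x -> subgroup_set N (x ^ g).

Definition finite_index (G : topologicalGroupType) (N : closedSubgroup G) :=
  finite_set [set lcoset t N | t in [set: G]].

Definition set_prod (G : topologicalGroupType) (n : nat)
    (N : 'I_n -> closedSubgroup G) : set G :=
  [set \prod_(i < n) x i | x in [set x : 'I_n -> G | forall i, subgroup_set (N i) (x i)]].

(** [f] exhibits [Q] as the quotient of [G] by the kernel of [f], up to
    isomorphism of topological groups. *)
Definition quotient_hom (G Q : topologicalGroupType) (f : G -> Q) :=
  [/\ {morph f : x y / x * y},
      range f = [set: Q] &
      forall U : set Q, open U <-> open (f @^-1` U)].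

Definition profinite_class := profiniteGroupType -> Prop.

Definition subgroup_closed (C : profinite_class) :=
  forall (G : profiniteGroupType) (H : closedSubgroup G),
    C G -> C (subgroup_profinite H).

(** Since [quotient_hom] includes isomorphisms, this also makes [C] invariant
    under isomorphism of topological groups. *)
Definition quotient_closed (C : profinite_class) :=
  forall (G Q : profiniteGroupType) (f : G -> Q), quotient_hom f -> C G -> C Q.

(** The product of finitely many closed normal subgroups of a profinite group
    is always a closed subgroup; [P] is that product.  The families are
    nonempty, so the empty class is not excluded. *)
Definition normal_product_closed (C : profinite_class) :=
  forall (G : profiniteGroupType) (n : nat) (N : 'I_n.+1 -> closedSubgroup G)
         (P : closedSubgroup G),
    (forall i, normal_subgroup (N i)) -> (forall i, C (subgroup_profinite (N i))) ->
    subgroup_set P = set_prod N ->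
    C (subgroup_profinite P).

Definition virtually (C : profinite_class) (G : profiniteGroupType) :=
  exists N : closedSubgroup G,
    [/\ normal_subgroup N, finite_index N & C (subgroup_profinite N)].

(** Words are terms, not reduced elements of a free group; values are the same
    for all terms representing the same element. *)
Inductive gword : Type :=
| Wvar of nat
| Wone
| Wmul of gword & gword
| Winv of gword.

Definition Wcomm (u v : gword) : gword :=
  Wmul (Winv u) (Wmul (Winv v) (Wmul u v)).

Fixpoint wvars (w : gword) : seq nat :=
  match w with
  | Wvar i => [:: i]
  | Wone => [::]
  | Wmul u v => wvars u ++ wvars v
  | Winv u => wvars u
  end.

Inductive multilinear_commutator : gword -> Prop :=
| mlc_var i : multilinear_commutator (Wvar i)
| mlc_comm u v :
    multilinear_commutator u -> multilinear_commutator v ->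
    ~~ has (mem (wvars u)) (wvars v) ->
    multilinear_commutator (Wcomm u v).

Fixpoint weval (G : groupType) (g : nat -> G) (w : gword) : G :=
  match w with
  | Wvar i => g i
  | Wone => 1
  | Wmul u v => weval g u * weval g v
  | Winv u => (weval g u)^-1
  end.

Definition wvalues (G : groupType) (w : gword) : set G :=
  [set weval g w | g in [set: nat -> G]].
Arguments wvalues G w : clear implicits.

Definition verbal_subgroup (G : profiniteGroupType) (w : gword) :
  closedSubgroup G := closed_generated (wvalues G w).

(* Main.v *)
(** Suppose that the values of [w] are covered by countably many cosets of
    subgroups in the class. By a Baire category argument some coset box
    [b_1 H x ... x b_n H], with [H] open normal, is mapped by [w] into one coset
    [t K]. The quotients of these values lie in the [H]-core of [K], and the
    product of the finitely many conjugates of its intersection with [H] is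
    in the class and normal in [G]; modulo it [w] is constant on the box, hence
    trivial as soon as some entry of the box is replaced by an element of [H].
    Treating all cosets and all sets of positions by induction yields a normal
    subgroup [N] in the class and an open normal [H] such that [w (g) \in N]
    whenever some [g_i \in H]. Finally [w (G) N / N] is finite: if [w = [u, v]],
    then by induction [u (G)] and [v (G)] are finite modulo the centralisers of
    each other, and Baer's theorem applies.

    The converse holds because a subgroup of finite index has finitely many
    cosets. *)
From HB Require Import structures.
Require Import Defs.
From mathcomp Require Import all_boot all_classical topology zify.

Set Implicit Arguments.
Unset Strict Implicit.
Unset Printing Implicit Defensive.

Local Open Scope classical_set_scope.
Local Open Scope group_scope.

(** * Groups, quotients and words *)

Ltac group_nf :=
  rewrite /commg /conjg ?invgM ?invgK ?invg1 ?mulgA;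
  rewrite ?(mulgK, mulgVK, mulVg, mulgV, mul1g, mulg1).

(** Closedness is left out: quotients and the generated subgroups in Baer's theorem are treated as
    abstract groups. *)
Record is_subgroup (G : groupType) (A : set G) : Prop := IsSubgroup {
  is_subgroup1 : A 1;
  is_subgroupM : forall x y, A x -> A y -> A (x * y);
  is_subgroupV : forall x, A x -> A x^-1
}.

Record is_normal (G : groupType) (A : set G) : Prop := IsNormal {
  is_normal_subgroup :> is_subgroup A;
  is_normalJ : forall g x, A x -> A (x ^ g)
}.

Section Normal.
Variables (G : groupType) (H : set G).
Hypothesis nH : is_normal H.

Lemma normal1 : H 1. Proof. exact: is_subgroup1 nH. Qed.

Lemma normalM x y : H x -> H y -> H (x * y).
Proof. exact: is_subgroupM nH _ _. Qed.

Lemma normalV x : H x -> H x^-1.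
Proof. exact: is_subgroupV nH _. Qed.

Lemma normalJ g x : H x -> H (x ^ g).
Proof. exact: is_normalJ nH _ _. Qed.

(** [H (x^-1 * y)] expresses congruence of [x] and [y] modulo [H] without forming a quotient. *)
Lemma normal_divC x y : H (x^-1 * y) -> H (y^-1 * x).
Proof. by move=> /normalV; rewrite invgM invgK. Qed.

Lemma normal_div_trans y x z : H (x^-1 * y) -> H (y^-1 * z) -> H (x^-1 * z).
Proof. by move=> xy yz; have := normalM xy yz; rewrite mulgA mulgK. Qed.

Lemma normal_divE x y : H (x^-1 * y) -> H x <-> H y.
Proof.
move=> xy; split=> [Hx|Hy]; first by have := normalM Hx xy; rewrite mulVKg.
by have := normalM Hy (normalV xy); rewrite invgM invgK mulVKg.
Qed.

Lemma normal_divJ x y h : H h -> H (x^-1 * y) -> H (x^-1 * y ^ h).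
Proof.
move=> Hh xy; have -> : x^-1 * y ^ h = h^-1 ^ x * (x^-1 * y) * h by group_nf.
by apply: normalM => //; apply: normalM => //; apply/normalJ/normalV.
Qed.

Lemma normal_divMM x x' y y' :
  H (x^-1 * x') -> H (y^-1 * y') -> H ((x * y)^-1 * (x' * y')).
Proof.
move=> xx yy; have -> : (x * y)^-1 * (x' * y') = (x^-1 * x') ^ y * (y^-1 * y').
  by group_nf.
by apply: normalM => //; apply: normalJ.
Qed.

Lemma normal_divVV x y : H (x^-1 * y) -> H (x^-1^-1 * y^-1).
Proof.
move=> xy; rewrite (_ : _ * _ = (x^-1 * y)^-1 ^ x^-1); last by group_nf.
exact/normalJ/normalV.
Qed.

Lemma normal_commgl x y : H x -> H [~ x, y].
Proof. by move=> Hx; apply: normalM; [exact: normalV|exact: normalJ]. Qed.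

Lemma normal_commgr x y : H y -> H [~ x, y].
Proof. by move=> Hy; rewrite -invgR; apply/normalV/normal_commgl. Qed.

End Normal.

Lemma smallest_is_subgroup (G : groupType) (X : set G) :
  is_subgroup (smallest (@is_subgroup G) X).
Proof.
split=> [A [[]]//|x y Xx Xy A XA|x Xx A XA].
  by case: (XA) => -[_ AM _] _; apply: AM; [exact: Xx|exact: Xy].
by case: (XA) => -[_ _ AV] _; apply: AV; exact: Xx.
Qed.

(** For fixed [g], the elements whose conjugate by [g] lies in the generated subgroup form a
    subgroup containing [X]. *)
Lemma smallest_is_normal (G : groupType) (X : set G) :
  (forall g x, X x -> X (x ^ g)) -> is_normal (smallest (@is_subgroup G) X).
Proof.
move=> XJ; split=> [|g x Xx]; first exact: smallest_is_subgroup.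
have [S1 SM SV] := smallest_is_subgroup X.
apply: (smallest_sub (X := [set y | smallest (@is_subgroup G) X (y ^ g)])) Xx.
  by split=> [|y z|y] /=; rewrite ?conj1g ?conjMg ?conjVg //;
    [exact: SM|exact: SV].
by move=> y Xy; apply: sub_gen_smallest; exact: XJ.
Qed.

Section Quotient.
Variables (G : groupType) (N : set G).
Hypothesis nN : is_normal N.

Definition coset_rel : rel G := fun x y => `[< N (x^-1 * y) >].

Lemma coset_rel_equiv : equiv_class_of coset_rel.
Proof.
split=> [x|x y|y x z].
- by apply/asboolP; rewrite mulVg; exact: normal1.
- by apply/idP/idP => /asboolP xy; apply/asboolP; exact: normal_divC.
- by move=> /asboolP xy /asboolP yz; apply/asboolP/(normal_div_trans nN xy yz).
Qed.

Canonical coset_equiv := EquivRelPack coset_rel_equiv.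
Local Open Scope quotient_scope.
Definition coset_group := {eq_quot coset_rel}.
HB.instance Definition _ := Choice.on coset_group.

Definition coset_pi (x : G) : coset_group := \pi_({eq_quot coset_rel}) x.

Lemma coset_piP x y : coset_pi x = coset_pi y <-> N (x^-1 * y).
Proof.
split=> [/eqP|?]; first by rewrite eqmodE => /asboolP.
by apply/eqP; rewrite eqmodE; apply/asboolP.
Qed.

Lemma coset_reprK (q : coset_group) : coset_pi (repr q) = q.
Proof. exact: reprK. Qed.

Definition coset_mul (p q : coset_group) := coset_pi (repr p * repr q).
Definition coset_inv (p : coset_group) := coset_pi (repr p)^-1.

Lemma coset_piM x y : coset_pi (x * y) = coset_mul (coset_pi x) (coset_pi y).
Proof.
by apply/coset_piP/(normal_divMM nN); apply/coset_piP; rewrite coset_reprK.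
Qed.

Lemma coset_piV x : coset_pi x^-1 = coset_inv (coset_pi x).
Proof.
by apply/coset_piP/(normal_divVV nN); apply/coset_piP; rewrite coset_reprK.
Qed.

Lemma coset_mulA : associative coset_mul.
Proof.
move=> p q r; rewrite -(coset_reprK p) -(coset_reprK q) -(coset_reprK r).
by rewrite -!coset_piM mulgA.
Qed.

Lemma coset_mul1g : left_id (coset_pi 1) coset_mul.
Proof. by move=> p; rewrite -(coset_reprK p) -coset_piM mul1g. Qed.

Lemma coset_mulg1 : right_id (coset_pi 1) coset_mul.
Proof. by move=> p; rewrite -(coset_reprK p) -coset_piM mulg1. Qed.

Lemma coset_mulVg : left_inverse (coset_pi 1) coset_inv coset_mul.
Proof. by move=> p; rewrite -(coset_reprK p) -coset_piV -coset_piM mulVg. Qed.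

Lemma coset_mulgV : right_inverse (coset_pi 1) coset_inv coset_mul.
Proof. by move=> p; rewrite -(coset_reprK p) -coset_piV -coset_piM mulgV. Qed.

HB.instance Definition _ := isGroup.Build coset_group
  coset_mulA coset_mul1g coset_mulg1 coset_mulVg coset_mulgV.

(** Later arguments rely only on these properties, so that representatives stay hidden. *)
Lemma quotient_exists : exists (Q : groupType) (pi : G -> Q),
  [/\ {morph pi : x y / x * y}, {morph pi : x / x^-1},
      forall q, exists x, pi x = q & forall x y, pi x = pi y <-> N (x^-1 * y)].
Proof.
exists coset_group, coset_pi; split.
- exact: coset_piM.
- exact: coset_piV.
- by move=> q; exists (repr q); exact: coset_reprK.
- exact: coset_piP.
Qed.

End Quotient.

(** * Values of multilinear commutator words *)

Section Words.
Implicit Types (G : groupType) (w : gword) (I : pred nat).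

Definition upd G (g : nat -> G) s h := fun i => if i == s then h else g i.
(** When [u] and [v] share no variable, this combines independent assignments for them into one for
    [[u, v]]. *)
Definition merge G (u : gword) (g g' : nat -> G) :=
  fun i => if i \in wvars u then g i else g' i.

Lemma in_wvars_Wcomm u v i :
  (i \in wvars (Wcomm u v)) = (i \in wvars u) || (i \in wvars v).
Proof. by rewrite /= !mem_cat; do 2!case: (_ \in _). Qed.

Lemma weval_ext G w (g g' : nat -> G) :
  {in wvars w, g =1 g'} -> weval g w = weval g' w.
Proof.
elim: w => [i||u IHu v IHv|u IHu] gg' //=.
- by apply: gg'; rewrite inE.
- by rewrite IHu ?IHv // => i iuv; apply: gg'; rewrite /= mem_cat iuv ?orbT.
- by rewrite IHu.
Qed.

Lemma weval_morph G G' (f : G -> G') w (g : nat -> G) :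
  {morph f : x y / x * y} -> weval (f \o g) w = f (weval g w).
Proof.
move=> fM; have f1 : f 1 = 1 by apply: (mulgI (f 1)); rewrite -fM !mulg1.
have fV x : f x^-1 = (f x)^-1.
  by apply: (mulgI (f x)); rewrite -fM !mulgV.
by elim: w => //= [u -> v ->|u ->].
Qed.

Lemma wevalJ G w (g : nat -> G) x : weval (fun i => g i ^ x) w = weval g w ^ x.
Proof. by rewrite -(weval_morph (f := conjg^~ x))// => a b; exact: conjMg. Qed.

Lemma merge_evall G u (g g' : nat -> G) : weval (merge u g g') u = weval g u.
Proof. by apply: weval_ext => i; rewrite /merge => ->. Qed.

Lemma merge_evalr G u v (g g' : nat -> G) :
  ~~ has (mem (wvars u)) (wvars v) -> weval (merge u g g') v = weval g' v.
Proof.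
move=> /hasPn uv; apply: weval_ext => i /uv /=; rewrite /merge.
by move=> /negPf ->.
Qed.

Lemma weval_normal_div G w (H : set G) (g g' : nat -> G) : is_normal H ->
  (forall i, H ((g i)^-1 * g' i)) -> H ((weval g w)^-1 * weval g' w).
Proof.
move=> nH gg'; elim: w => //= [|u IHu v IHv|u IHu].
- by rewrite mulVg; exact: normal1.
- exact: normal_divMM.
- exact: normal_divVV.
Qed.

(** Modulo [H], a commutator with one trivial argument is trivial, and every variable lies in one of
    the two halves. *)
Lemma weval_normal G w (H : set G) (g : nat -> G) i : is_normal H ->
  multilinear_commutator w -> i \in wvars w -> H (g i) -> H (weval g w).
Proof.
move=> nH; elim=> [j|u v _ IHu _ IHv _].
  by rewrite inE => /eqP ->.
rewrite in_wvars_Wcomm => /orP[iu|iv] Hi.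
  by apply: normal_commgl => //; exact: IHu.
by apply: normal_commgr => //; exact: IHv.
Qed.

(* Only factors of H act by conjugation, hence the [y i] stay in [g i * H]. *)
Lemma weval_updM G w (H : set G) (g : nat -> G) s h : is_normal H ->
  multilinear_commutator w -> s \in wvars w -> H h ->
  exists2 y, forall i, H ((g i)^-1 * y i) &
    weval (upd g s (g s * h)) w = weval y w * weval (upd g s h) w.
Proof.
move=> nH mw + Hh; elim: mw => [j|u v mu IHu mv IHv uv].
  rewrite inE => /eqP <-; exists g => [i|]; last by rewrite /= /upd eqxx.
  by rewrite mulVg; exact: normal1.
have updN t x z : s \notin wvars t ->
    weval (upd g s x) t = weval (upd g s z) t.
  move=> st; apply: weval_ext => i it; rewrite /upd.
  by case: eqP it st => // -> ->.
have updg t x : s \notin wvars t -> weval (upd g s x) t = weval g t.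
  move=> st; apply: weval_ext => i it; rewrite /upd.
  by case: eqP it st => // -> ->.
rewrite in_wvars_Wcomm; have [su _|su /= sv] := boolP (s \in wvars u).
  have sv : s \notin wvars v.
    by apply: contra uv => sv; apply/hasP; exists s.
  have [y Hy /= ->] := IHu su; rewrite !(updg v) //.
  set x := weval y u; set e := weval _ u; set z := weval g v.
  have He : H e by apply: (weval_normal (i := s)); rewrite // /upd eqxx.
  (* From [[~ x * e, z] = [~ x, z] ^ e * [~ e, z]]. *)
  exists (fun i => merge u y g i ^ e) => [i|].
    apply: normal_divJ => //; rewrite /merge; case: ifP => // _.
    by rewrite mulVg; exact: normal1.
  rewrite !wevalJ merge_evall merge_evalr // -/x -/z.
  by group_nf.
have [y Hy /= ->] := IHv sv; rewrite !(updg u) //.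
set x := weval y v; set e := weval _ v; set z := weval g u.
have He : H e by apply: (weval_normal (i := s)); rewrite // /upd eqxx.
(* Here [[~ z, x * e] = [~ z, e] * [~ z, x] ^ e]; moving [[~ z, e]] to the right costs a further
   conjugation by its inverse. *)
have Hze : H (e * [~ z, e]^-1).
  by apply: (normalM nH) => //; apply/(normalV nH)/(normal_commgr nH).
exists (fun i => merge u g y i ^ (e * [~ z, e]^-1)) => [i|].
  apply: normal_divJ => //; rewrite /merge; case: ifP => // _.
  by rewrite mulVg; exact: normal1.
rewrite !wevalJ merge_evall merge_evalr // -/x -/z.
by group_nf.
Qed.

(* Each half of [w = [~ u, v]] is treated modulo the centraliser of the values
   of the other half. *)
Lemma weval_congr w : multilinear_commutator w ->
  forall G (D H : set G) I, is_normal D -> is_normal H ->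
  (forall i c, i \in wvars w -> I i -> H (c i) ->
     (forall j, ~~ I j -> H (c j)) -> D (weval c w)) ->
  forall c c', (forall j, I j -> H ((c j)^-1 * c' j)) ->
    (forall j, ~~ I j -> H (c j) /\ c j = c' j) ->
  D ((weval c w)^-1 * weval c' w).
Proof.
(* This set is the centraliser of [V] modulo [D]. *)
have centn G (D V : set G) : is_normal D -> (forall g x, V x -> V (x ^ g)) ->
    is_normal [set d | forall z, V z -> D [~ d, z]].
  move=> nD VJ; split; first split=> [z Vz|x y Dx Dy z Vz|x Dx z Vz] /=.
  - by rewrite comm1g; exact: normal1.
  - have -> : [~ x * y, z] = [~ x, z] ^ y * [~ y, z] by group_nf.
    by apply: normalM; [|apply: normalJ; [|exact: Dx]|exact: Dy].
  - have -> : [~ x^-1, z] = [~ x, z]^-1 ^ x^-1 by group_nf.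
    by apply/(normalJ nD)/(normalV nD)/Dx.
  - move=> g x Dx z Vz /=.
    by rewrite -(conjgKV g z) -conjRg; apply/(normalJ nD)/Dx/VJ.
elim=> [s|u v mu IHu mv IHv uv] G D H I nD nH wD c c' cc' cc'N.
  have [Is|Is] := boolP (I s); last first.
    by have [_ /= ->] := cc'N s Is; rewrite mulVg; exact: normal1.
  pose d j := if j == s then (c s)^-1 * c' s else 1.
  suff : D (weval d (Wvar s)) by rewrite /= /d eqxx.
  apply: (wD s); rewrite ?inE // /d ?eqxx; first exact: cc'.
  by move=> j; case: eqP => [-> /negP//|_ _]; exact: normal1.
(* The values of [t] that the hypothesis on [w] can handle: entries outside [I] lie in [H], the
   others are arbitrary. *)
pose V t :=
  [set z : G | exists2 b, forall j, ~~ I j -> H (b j) & z = weval b t].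
have VJ t g x : V t x -> V t (x ^ g).
  move=> [b Hb ->]; exists (fun j => b j ^ g); last by rewrite wevalJ.
  by move=> j Ij; apply: normalJ => //; exact: Hb.
have Vc t : V t (weval c t) by exists c => // j /cc'N[].
have Vc' t : V t (weval c' t) by exists c' => // j /cc'N[? <-].
have Du : [set d | forall z, V v z -> D [~ d, z]]
    ((weval c u)^-1 * weval c' u).
  apply: (IHu _ _ _ I (centn _ _ _ nD (VJ v)) nH _ _ _ cc' cc'N).
  move=> i b iu Ii Hbi Hb z [b' Hb' ->] /=.
  rewrite -(merge_evall u b b') -(merge_evalr b b' uv).
  apply: (wD i) => //; rewrite ?in_wvars_Wcomm ?iu // /merge ?iu//.
  by move=> j Ij; case: ifP => _; [exact: Hb|exact: Hb'].
have Dv : [set d | forall z, V u z -> D [~ d, z]]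
    ((weval c v)^-1 * weval c' v).
  apply: (IHv _ _ _ I (centn _ _ _ nD (VJ u)) nH _ _ _ cc' cc'N).
  move=> i b iv Ii Hbi Hb z [b' Hb' ->] /=.
  rewrite -invgR; apply: normalV => //.
  rewrite -(merge_evall u b' b) -(merge_evalr b' b uv).
  have iu : i \in wvars u = false.
    by apply: contraNF uv => iu; apply/hasP; exists i.
  apply: (wD i) => //; rewrite ?in_wvars_Wcomm ?iv ?orbT // /merge ?iu//.
  by move=> j Ij; case: ifP => _; [exact: Hb'|exact: Hb].
have := normalJ (centn _ _ _ nD (VJ v)) (weval c u)^-1 Du.
have := normalJ (centn _ _ _ nD (VJ u)) (weval c v)^-1 Dv.
move=> /(_ _ (Vc' u)) + /(_ _ (Vc v)) /=.
set x := weval c u; set x' := weval c' u.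
set z := weval c v; set z' := weval c' v => Dz Dx.
(* The path runs through [[~ x', z]]. The conjugations above turned the two quotients into
   [x' * x^-1] and [z' * z^-1]. *)
apply: (normal_div_trans nD (y := [~ x', z])).
  by have := normalJ nD (x * [~ x', z]) Dx; congr D; group_nf.
have := normalJ nD (z * [~ z', x'] * [~ z', x']^-1) (normalV nD Dz).
by congr D; group_nf.
Qed.

End Words.

(** * A theorem of Baer and finiteness of verbal subgroups *)

Section FiniteProducts.
Variables (G : groupType) (X : set G).

(** The length is exact; once [1] is in [X], padding makes these sets increase with [n]. *)
Definition prods n : set G := [set p | exists l : seq G,
  [/\ size l = n, {in l, forall x, X x} & p = \prod_(x <- l) x]].

Hypothesis finX : finite_set X.
Hypothesis X1 : X 1.
Hypothesis XV : forall x, X x -> X x^-1.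
Hypothesis XJ : forall x y, X x -> X y -> X (x ^ y).
Hypothesis Xpow : forall x, X x -> exists m, prods m (x ^+ m.+1).

Lemma prods_cat m n p q : prods m p -> prods n q -> prods (m + n) (p * q).
Proof.
move=> [l [<- lX ->]] [k [<- kX ->]]; exists (l ++ k).
split; rewrite ?size_cat ?big_cat //.
by move=> x; rewrite mem_cat => /orP[/lX|/kX].
Qed.

Lemma prods1 x : X x -> prods 1 x.
Proof.
move=> Xx; exists [:: x]; split; rewrite ?big_seq1 // => y.
by rewrite inE => /eqP ->.
Qed.

Lemma prodsX n x : X x -> prods n (x ^+ n).
Proof.
move=> Xx; elim: n => [|n IHn]; first by exists [::]; split; rewrite ?big_nil.
by rewrite expgS -add1n; apply: prods_cat => //; exact: prods1.
Qed.

Lemma prods_finite n : finite_set (prods n).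
Proof.
elim: n => [|n IHn].
  apply: (sub_finite_set _ (finite_set1 1)) => p [l [/size0nil -> _ ->]].
  by rewrite big_nil.
apply: (sub_finite_set _ (finite_image2 mul finX IHn)).
move=> p [[|x l] [//= [sl] lX ->]]; exists x.
  by apply: lX; rewrite inE eqxx.
exists (\prod_(y <- l) y); last by rewrite big_cons.
by exists l; split=> // y yl; apply: lX; rewrite inE yl orbT.
Qed.

(* Moves all the occurrences of [x] to the front. *)
Lemma prods_gather x l : X x -> {in l, forall y, X y} ->
  exists2 q, prods (size l - count_mem x l) q &
    \prod_(y <- l) y = x ^+ count_mem x l * q.
Proof.
move=> Xx; elim: l => [|y l IHl] lX.
  by exists 1; rewrite ?big_nil ?mulg1 //; exists [::]; split; rewrite ?big_nil.
have [|q ql lq] := IHl; first by move=> z zl; apply: lX; rewrite inE zl orbT.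
rewrite big_cons lq /=; case: (eqVneq y x) => [->|yx] /=.
  by exists q; rewrite ?add1n ?subSS // expgS mulgA.
rewrite add0n subSn ?count_size //.
have Xk k : X (y ^ (x ^+ k)).
  elim: k => [|k IHk]; first by rewrite conjg1; apply: lX; rewrite inE eqxx.
  by rewrite expgSr conjgM; exact: XJ.
exists (y ^ (x ^+ count_mem x l) * q); last first.
  by rewrite [RHS]mulgA -conjgC -mulgA.
by rewrite -add1n; apply: prods_cat => //; exact: prods1.
Qed.

Lemma size_le_count (s l : seq G) : {subset l <= s} ->
  (size l <= \sum_(x <- s) count_mem x l)%N.
Proof.
elim: l => [//|y l IHl] ls /=; rewrite big_split /= -add1n leq_add //.
  have /splitPr[s1 s2] : y \in s by apply: ls; rewrite inE eqxx.
  by rewrite big_cat big_cons /= eqxx addnCA leq_addr.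
by apply: IHl => z zl; apply: ls; rewrite inE zl orbT.
Qed.

(* Some [x] occurs often enough in a long product for [Xpow] to shorten it. *)
Lemma prods_bounded : exists L, forall n, prods n `<=` prods L.
Proof.
have /choice[m Xm] : forall x, exists m, X x -> prods m (x ^+ m.+1).
  move=> x; have [Xx|nXx] := pselect (X x); last by exists 0%N.
  by have [m ?] := Xpow Xx; exists m.
have [s Xs] := (finite_seqP X).1 finX.
pose L := (\sum_(x <- s) m x)%N; exists L.
have shorten n : (L < n)%N -> prods n `<=` prods n.-1.
  move=> Ln p [l [sl lX ->]].
  have [x Xx xl] : exists2 x, X x & (m x < count_mem x l)%N.
    apply: contrapT => nx.
    have : (size l <= L)%N.
      apply: leq_trans (size_le_count (s := s) _) _ => [x /lX|].
        by rewrite Xs.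
      rewrite /L !big_seq; apply: leq_sum => x xs; rewrite leqNgt.
      by apply/negP => mx; apply: nx; exists x; rewrite ?Xs.
    by rewrite sl leqNgt Ln.
  have [q ql ->] := prods_gather Xx lX.
  (* Of the copies of [x] in front, [(m x).+1] are replaced by [m x] factors. *)
  have -> :
      n.-1 = (count_mem x l - (m x).+1 + m x + (size l - count_mem x l))%N.
    have := count_size (pred1 x) l; rewrite -sl.
    move: (count_mem x l) (size l) (m x) xl => a b c; lia.
  apply: prods_cat ql.
  have -> : x ^+ count_mem x l =
      x ^+ (count_mem x l - (m x).+1) * x ^+ (m x).+1.
    by rewrite -expgnDr subnK.
  by apply: prods_cat; [exact: prodsX|exact: Xm].
have pad n k : (n <= k)%N -> prods n `<=` prods k.
  move=> nk p pn; rewrite -(subnK nk) -[p]mul1g -(expg1n _ (k - n)).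
  by apply: prods_cat => //; exact: prodsX.
elim=> [|n IHn]; first exact: pad.
by have [/shorten/subset_trans|] := ltnP L n.+1; [exact|exact: pad].
Qed.

(** With [L] from [prods_bounded], products of any length, in particular [L + L], fall back into
    [prods L]. *)
Lemma prods_finite_subgroup :
  exists P : set G, [/\ finite_set P, is_subgroup P & X `<=` P].
Proof.
have [L LX] := prods_bounded.
exists (prods L); split; [exact: prods_finite| |]; last first.
  by move=> x /prods1; exact: LX.
split=> [|x y xL yL|x [l [_ lX ->]]].
- by apply/(LX 1%N)/prods1.
- exact/(LX (L + L)%N)/prods_cat.
- apply: (LX (size l)); elim: l lX => [|y l IHl] lX.
    by exists [::]; rewrite !big_nil invg1.
  rewrite big_cons invgM /= -addn1; apply: prods_cat.
    by apply: IHl => z zl; apply: lX; rewrite inE zl orbT.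
  by apply/prods1/XV/lX; rewrite inE eqxx.
Qed.

End FiniteProducts.

(** [D] need not lie in [A]. The representatives do, so that commutators with them are still
    commutators of elements of [A]. *)
Definition finite_mod (G : groupType) (A D : set G) :=
  exists R : set G, [/\ finite_set R, R `<=` A &
    forall a, A a -> exists2 r, R r & D (r^-1 * a)].

Definition centraliser (G : groupType) (B : set G) : set G :=
  [set x | forall y, B y -> commute x y].

Lemma centraliser_subgroup (G : groupType) (B : set G) :
  is_subgroup (centraliser B).
Proof.
split=> [y _|x x' Bx Bx' y yB|x Bx y yB].
- exact/commute_sym/commute1.
- by apply/commute_sym/commuteM; apply/commute_sym; [exact: Bx|exact: Bx'].
- exact/commute_sym/commuteV/commute_sym/Bx.
Qed.

(** By the pigeonhole principle two distinct powers of [x] lie in the same coset of [D]. *)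
Lemma finite_mod_pow (G : groupType) (A D : set G) x :
  is_subgroup A -> is_subgroup D -> finite_mod A D -> A x ->
  exists n, D (x ^+ n.+1).
Proof.
move=> [A1 AM _] [_ DM DV] [R [finR _ RA]] Ax.
have AX n : A (x ^+ n) by elim: n => [//|n IHn]; rewrite expgS; exact: AM.
have /choice[f fR] : forall n, exists r, R r /\ D (r^-1 * x ^+ n).
  by move=> n; have [r] := RA _ (AX n); exists r.
have [s Rs] := (finite_seqP R).1 finR.
suff [i [j [ij fij]]] : exists i j, (i < j)%N /\ f i = f j.
  exists (j - i).-1; rewrite prednK ?subn_gt0 // expgnFr 1?ltnW //.
  have [_ Di] := fR i; have [_ Dj] := fR j; rewrite -fij in Dj.
  have := DM _ _ (DV _ Di) Dj; rewrite invgM invgK mulgA mulgK.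
  by rewrite (commuteV (commuteX2 j i (commute_refl x))).
apply: contrapT => nf.
have : uniq (map f (iota 0 (size s).+1)).
  rewrite map_inj_uniq ?iota_uniq // => i j fij; apply: contrapT => /eqP.
  by rewrite neq_ltn => /orP[] ij; apply: nf;
    [exists i, j|exists j, i].
have sub : {subset map f (iota 0 (size s).+1) <= s}.
  by move=> _ /mapP[n _ ->]; have [] := fR n; rewrite Rs.
by move=> /uniq_leq_size /(_ sub); rewrite size_map size_iota ltnn.
Qed.

Lemma commute_commg1 (G : groupType) (x y : G) : commute x y -> [~ x, y] = 1.
Proof. by move=> /commgP/eqP. Qed.

Lemma commute_conjg (G : groupType) (x y : G) : commute x y -> x ^ y = x.
Proof. by move=> /commgP/conjg_fixP. Qed.

(* Baer's theorem; the power relation is Rosenlicht's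
   [c ^ (n+1) = [a, b^2] (c^b)^(n-1)], valid for [c = [a, b]] if [c^n] commutes
   with [b]. *)
Lemma commutators_finite (G : groupType) (A B : set G) :
  is_normal A -> is_normal B ->
  finite_mod A (centraliser B) -> finite_mod B (centraliser A) ->
  exists P : set G, [/\ finite_set P, is_subgroup P &
    forall a b, A a -> B b -> P [~ a, b]].
Proof.
move=> nA nB finA finB.
pose X : set G := [set [~ a, b] | a in A & b in B].
have XA x : X x -> A x by move=> [a Aa [b Bb <-]]; exact: (normal_commgl nA).
have XB x : X x -> B x by move=> [a Aa [b Bb <-]]; exact: (normal_commgr nB).
have inX a b : A a -> B b -> X [~ a, b].
  by move=> Aa Bb; exists a => //; exists b.
have XJ x g : X x -> X (x ^ g).
  move=> [a Aa [b Bb <-]]; rewrite conjRg.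
  by apply: inX; [exact: (normalJ nA)|exact: (normalJ nB)].
have finX : finite_set X.
  have [R [finR RA AR]] := finA; have [S [finS SB BS]] := finB.
  apply: (sub_finite_set _ (finite_image2 (@commg G) finR finS)).
  move=> _ [a Aa [b Bb <-]].
  have [r Rr ra] := AR a Aa; have [s Ss sb] := BS b Bb.
  exists r => //; exists s => //.
  have Ar := RA _ Rr; have Bs := SB _ Ss.
  (* [d] centralises [B], which contains [[~ r, b]]; hence [[~ r * d, b] = [~ r, b]]. The second
     entry is treated in the same way. *)
  rewrite -[in RHS](mulVKg r a); set d := r^-1 * a in ra *.
  have -> : [~ r * d, b] = [~ r, b] ^ d * [~ d, b] by group_nf.
  rewrite (commute_commg1 (ra _ Bb)) mulg1 commute_conjg; last first.
    exact/commute_sym/ra/XB/inX.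
  rewrite -[in RHS](mulVKg s b); set e := s^-1 * b in sb *.
  have -> : [~ r, s * e] = [~ r, e] * [~ r, s] ^ e by group_nf.
  rewrite (commute_commg1 (commute_sym (sb _ Ar))).
  by rewrite mul1g commute_conjg //; exact/commute_sym/sb/XA/inX.
have [||||P [finP sP XP]] := prods_finite_subgroup finX.
- by rewrite -(comm1g (1 : G)); apply: inX; exact: normal1.
- move=> _ [a Aa [b Bb <-]].
  rewrite (_ : _^-1 = [~ a^-1, b] ^ a); last by group_nf.
  by apply/XJ/inX => //; exact: (normalV nA).
- by move=> x y Xx _; exact: XJ.
- move=> c Xc.
  have [n cn] := finite_mod_pow nA (centraliser_subgroup B) finA (XA _ Xc).
  exists n.+1; case: Xc (Xc) => a Aa [b Bb cab] Xc.
  have -> : c ^+ n.+2 = [~ a, b * b] * (c ^ b) ^+ n.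
    have -> : [~ a, b * b] = c * c ^ b by rewrite -cab; group_nf.
    rewrite -mulgA -expgS -conjXg commute_conjg -?expgS //; exact: cn.
  rewrite -add1n; apply: prods_cat.
    by apply/prods1/inX => //; exact: (normalM nB).
  by apply: prodsX; exact: XJ.
by exists P; split=> // a b Aa Bb; exact/XP/inX.
Qed.

(** Quantifying over all groups lets the induction on [w] pass to quotients. *)
Definition finite_verbal w := forall (G : groupType) (H : set G),
  is_normal H -> finite_mod setT H ->
  (forall (g : nat -> G) i, i \in wvars w -> H (g i) -> weval g w = 1) ->
  exists P : set G, [/\ finite_set P, is_subgroup P & wvalues G w `<=` P].

Lemma finite_verbal_quotient w (G : groupType) (H D : set G) :
  finite_verbal w -> is_normal H -> finite_mod setT H -> is_normal D ->
  (forall (g : nat -> G) i, i \in wvars w -> H (g i) -> D (weval g w)) ->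
  exists (Q : groupType) (pi : G -> Q) (P : set Q),
    [/\ forall x y, pi x = pi y <-> D (x^-1 * y), finite_set P,
        is_subgroup (pi @^-1` P) & wvalues G w `<=` pi @^-1` P].
Proof.
move=> fw nH [R [finR _ RH]] nD wD.
have [Q [pi [piM piV pi_onto piP]]] := quotient_exists nD.
have pi1 : pi 1 = 1 by apply: (mulgI (pi 1)); rewrite -piM !mulg1.
have piJ x y : pi (x ^ y) = pi x ^ pi y by rewrite /conjg !piM piV.
have [|||P [finP sP wP]] := fw Q [set pi x | x in H].
- split=> [|q _ [x Hx <-]]; last first.
    by have [y <-] := pi_onto q; exists (x ^ y) => //; exact: (normalJ nH).
  split; first by exists 1 => //; exact: (normal1 nH).
    move=> _ _ [x Hx <-] [y Hy <-].
    by exists (x * y) => //; exact: (normalM nH).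
  by move=> _ [x Hx <-]; exists x^-1 => //; exact: (normalV nH).
- exists [set pi x | x in R]; split=> // [|q _]; first exact: finite_image.
  have [x <-] := pi_onto q; have [//|r Rr rx] := RH x.
  by exists (pi r); [exists r|exists (r^-1 * x); rewrite // piM piV].
- move=> g i iw [h Hh hi].
  have /choice[f fg] := fun j => pi_onto (g j).
  (* The tuple is lifted with its [i]-th entry inside [H], so that the hypothesis on [D] applies. *)
  have -> : g = pi \o upd f i h.
    by apply/funext => j; rewrite /upd /=; case: eqP => [->|_]; rewrite ?fg.
  rewrite (weval_morph _ _ piM) -pi1; apply/esym/piP.
  by rewrite invg1 mul1g; apply: (wD _ i) => //; rewrite /upd eqxx.
exists Q, pi, P; split=> // [|_ [g _ <-] /=].
  split=> [|x y Px Py|x Px] /=; rewrite ?pi1 ?piM ?piV.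
  - exact: (is_subgroup1 sP).
  - exact: (is_subgroupM sP).
  - exact: (is_subgroupV sP).
by apply: wP; exists (pi \o g) => //; rewrite weval_morph.
Qed.

(* For [w = [~ u, v]], by induction the subgroup generated by the values of [u]
   is finite modulo the centraliser of the values of [v], and conversely. *)
Lemma verbal_finite w : multilinear_commutator w -> finite_verbal w.
Proof.
(* Modulo the centraliser of [V] the word [u] vanishes once an entry lies in [H], so the induction
   hypothesis applies in that quotient. *)
have gen_mod (G : groupType) (H : set G) u (V : set G) :
    is_normal H -> finite_mod setT H -> finite_verbal u ->
    (forall g x, V x -> V (x ^ g)) ->
    (forall g i z, i \in wvars u -> H (g i) -> V z -> commute (weval g u) z) ->
  finite_mod (smallest (@is_subgroup G) (wvalues G u))
    (centraliser (smallest (@is_subgroup G) V)).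
  move=> nH finH fu VJ uV.
  set W := smallest _ _; set Z := centraliser _.
  have nD : is_normal (centraliser V).
    split=> [|g x xV y Vy]; first exact: centraliser_subgroup.
    have xy := xV _ (VJ g^-1 _ Vy).
    by rewrite -(conjgKV g y) /commute -!conjMg xy.
  have DZ : centraliser V `<=` Z.
    move=> x xV; apply: (smallest_sub (X := [set y | commute x y])) => //.
    split=> [|y z|y] /=; [exact: commute1|exact: commuteM|exact: commuteV].
  have [|Q [pi [P [piP finP sP uP]]]] := finite_verbal_quotient fu nH finH nD.
    by move=> g i iu Hi z; exact: (uV _ i).
  have WP : W `<=` pi @^-1` P by exact: smallest_sub.
  (* [f] picks preimages inside [W], with default [1] off the image of [W]. *)
  have /choice[f fP] : forall q, exists a,
      (exists b, W b /\ pi b = q) -> W a /\ pi a = q.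
    move=> q; have [[b Wb]|nb] := pselect (exists b, W b /\ pi b = q).
      by exists b.
    by exists 1.
  exists (f @` P `&` W); split.
  - by apply: finite_setIl; exact: finite_image.
  - by move=> x [].
  - move=> a Wa; have [|Wf pf] := fP (pi a); first by exists a.
    exists (f (pi a)); first by split=> //; exists (pi a) => //; exact: WP.
    by apply/DZ/piP.
have VJ (G : groupType) w' (g x : G) :
    wvalues G w' x -> wvalues G w' (x ^ g).
  by move=> [b _ <-]; exists (fun i => b i ^ g) => //; rewrite wevalJ.
elim=> [s|u v mu IHu mv IHv uv] G H nH finH wH.
  (* For a variable, the hypothesis makes [H] trivial, so [G] itself is finite. *)
  exists setT; split=> //; have [R [finR _ RH]] := finH.
  apply: sub_finite_set finR => x _; have [//|r Rr rx] := RH x.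
  suff -> : x = r by [].
  have := wH (fun=> r^-1 * x) s.
  rewrite inE eqxx => /(_ isT rx) /= /(congr1 (mul r)).
  by rewrite mulVKg mulg1.
have uv_comm (g g' : nat -> G) i :
    (i \in wvars u /\ H (g i)) \/ (i \in wvars v /\ H (g' i)) ->
    commute (weval g u) (weval g' v).
  move=> iuv; apply/commgP/eqP.
  rewrite -(merge_evall u g g') -(merge_evalr g g' uv).
  case: iuv => -[ii Hi]; apply: (wH (merge u g g') i);
    rewrite ?in_wvars_Wcomm ?ii ?orbT // /merge ?ii //.
  by rewrite ifN //; apply: contra uv => iu; apply/hasP; exists i.
have [||||P [finP sP AP]] := @commutators_finite G
  (smallest (@is_subgroup G) (wvalues G u))
  (smallest (@is_subgroup G) (wvalues G v)).
- by apply: smallest_is_normal; exact: VJ.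
- by apply: smallest_is_normal; exact: VJ.
- apply: (gen_mod _ H) => // [|g i _ iu Hi [g' _ <-]]; first exact: VJ.
  by apply: (uv_comm _ _ i); left.
- apply: (gen_mod _ H) => // [|g i _ iv Hi [g' _ <-]]; first exact: VJ.
  by apply/commute_sym/(uv_comm _ _ i); right.
exists P; split=> // _ [g _ <-].
by apply: AP; apply: sub_gen_smallest; exists g.
Qed.

(** * Open normal subgroups of profinite groups *)

Section Compact.
Variable T : topologicalType.
Hypothesis cptT : compact [set: T].

(** Otherwise the sets [C \ W] generate a proper filter; a cluster point lies in every [C], hence in
    the open set [W], which misses them all. With [W] empty this is the finite intersection
    property. *)
Lemma compact_directed (D : set (set T)) (W : set T) :
  D !=set0 -> D `<=` closed -> open W ->
  (forall A B, D A -> D B -> exists2 C, D C & C `<=` A `&` B) ->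
  (forall x, (forall C, D C -> C x) -> W x) ->
  exists2 C, D C & C `<=` W.
Proof.
move=> D0 Dcl oW DI DW; apply: contrapT => nW.
pose F := filter_from D (fun C => C `\` W).
have FF : ProperFilter F.
  apply: filter_from_proper => [|C DC].
    apply: filter_from_filter => // A B DA DB; have [C DC CAB] := DI _ _ DA DB.
    by exists C => // x [/CAB[? ?] nWx].
  apply: contrapT => CW; apply: nW; exists C => // x Cx.
  by apply: contrapT => nWx; apply: CW; exists x.
have [x [_ clx]] := cptT FF filterT.
have Dx C : D C -> C x.
  move=> DC; apply: (Dcl _ DC) => V xV.
  by have [|y [[Cy _] Vy]] := clx (C `\` W) V _ xV; [exists C|exists y].
have [A DA] := D0.
have Wx : nbhs x W by apply: open_nbhs_nbhs; split=> //; exact: DW.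
have [|y [[_ nWy] Wy]] := clx (A `\` W) W _ Wx; first by exists A.
exact: nWy.
Qed.

(** In a compact Hausdorff space the quasi-component [Q] of [x], the intersection of its clopen
    neighbourhoods, is connected. *)
Lemma totally_disconnected_zero_dimensional : hausdorff_space T ->
  totally_disconnected [set: T] -> zero_dimensional T.
Proof.
move=> hT tdT x y xy; apply: contrapT => nU.
pose D := [set C : set T | clopen C /\ C x].
pose Q := \bigcap_(C in D) C.
have Qx : Q x by move=> C [].
have Qy : Q y.
  by move=> C [cC Cx]; apply: contrapT => nCy; apply: nU; exists C.
suff cQ : connected Q.
  have : connected_component [set: T] x y by exists Q.
  by rewrite tdT // => /esym/eqP; rewrite (negPf xy).
have clQ : closed Q by apply: closed_bigI => C [[]].
move=> B B0 [C1 oC1 BC1] [C2 cC2 BC2].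
have cB : closed B by rewrite BC2; exact: closedI.
pose A := Q `\` C1.
have cA : closed A by apply: closedI => //; exact: open_closedC.
have AB : A `&` B = set0.
  by rewrite BC1; apply/seteqP; split=> // z [[_ nC1] [_ /nC1]].
have QAB : Q `<=` A `|` B.
  move=> z Qz; have [C1z|nC1z] := pselect (C1 z); [right|left] => //.
  by rewrite BC1.
(* By normality some open [O] contains [U] and has closure disjoint from [V]; a clopen neighbourhood
   of [x] that avoids the boundary of [O] is then cut down to [O]. *)
have key U V : closed U -> closed V -> U `&` V = set0 -> Q `<=` U `|` V ->
    U x -> V `&` Q = set0.
  move=> cU cV UV QUV Ux.
  have : set_nbhs U (~` V).
    apply/set_nbhsP; exists (~` V); split=> //; first exact: closed_openC.
    by apply/disjoints_subset.
  move/(compact_normal hT cptT cU) => [U' /set_nbhsP [O [oO UO OU']] clU'].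
  pose W := O `|` ~` closure O.
  have [|||||C [[oC cC] Cx] CW] := @compact_directed D W.
  - by exists setT; split=> //; exact: clopenT.
  - by move=> C [[]].
  - by apply: openU => //; apply/closed_openC/closed_closure.
  - move=> C C' [? ?] [? ?].
    by exists (C `&` C') => //; split=> //; exact: clopenI.
  - move=> z Qz; have [/UO|Vz] := QUV _ Qz; [by left|right].
    by move=> /(closureS OU')/clU'.
  have DCO : D (C `&` O).
    split; last by split => //; exact: UO.
    split; first exact: openI.
    have -> : C `&` O = C `&` closure O.
      apply/seteqP; split=> z [Cz Oz]; split=> //; first exact: subset_closure.
      by have [] := CW _ Cz.
    by apply: closedI => //; exact: closed_closure.
  apply/seteqP; split=> // z [Vz Qz].
  by have [_ /subset_closure/(closureS OU')/clU'] := Qz _ DCO.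
have BQ : B `<=` Q by rewrite BC1 => z [].
apply/seteqP; split=> // z Qz.
have [Ax|Bx] := QAB _ Qx.
  have := key _ _ cA cB AB QAB Ax; case: B0 => b Bb.
  by move/seteqP => [/(_ b) + _]; case; split=> //; exact: BQ.
have [Az|//] := QAB _ Qz.
have := key _ _ cB cA; rewrite setIC setUC => /(_ AB QAB Bx).
by move=> /seteqP[/(_ z) + _]; case.
Qed.

End Compact.

Lemma mulg_cvg (G : topologicalGroupType) (X : topologicalType) (f g : X -> G) :
  continuous f -> continuous g -> continuous (fun x => f x * g x).
Proof.
move=> cf cg x.
apply: (@continuous_comp _ _ _ (fun x => (f x, g x))
  (fun p : G * G => p.1 * p.2)).
  by apply: cvg_pair; [exact: cf|exact: cg].
exact: mulg_continuous.
Qed.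

Section Profinite.
Variable G : profiniteGroupType.
Implicit Types (H : set G) (x : G).

Record open_normal H : Prop := OpenNormal {
  open_normal_normal :> is_normal H;
  open_normal_open : open H
}.

Lemma lcoset_preimage x (A : set G) : lcoset x A = (fun y => x^-1 * y) @^-1` A.
Proof.
apply/seteqP; split=> [_ [h Ah <-]|y Ay] /=; first by rewrite mulKg.
by exists (x^-1 * y) => //; rewrite mulVKg.
Qed.

Lemma mulgl_continuous x : continuous (fun y : G => x * y).
Proof.
by apply: mulg_cvg; [exact: cst_continuous|move=> z; exact: cvg_id].
Qed.

Lemma open_lcoset x (A : set G) : open A -> open (lcoset x A).
Proof.
rewrite lcoset_preimage => oA; apply: open_comp => // y _.
exact: mulgl_continuous.
Qed.

Lemma closed_lcoset x (A : set G) : closed A -> closed (lcoset x A).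
Proof.
rewrite lcoset_preimage => cA; apply: closed_comp => // y _.
exact: mulgl_continuous.
Qed.

Lemma open_normal_closed H : open_normal H -> closed H.
Proof.
move=> oH; rewrite -(setCK H); apply: open_closedC.
have -> : ~` H = \bigcup_(x in ~` H) lcoset x H.
  apply/seteqP; split=> [x nHx|_ [x nHx [h Hh <-]] /=]; first exists x => //.
    by exists 1; rewrite ?mulg1 //; exact: (normal1 oH).
  move=> Hxh; apply: nHx; rewrite -(mulgK h x).
  by apply: (normalM oH) => //; exact: (normalV oH).
by apply: bigcup_open => x _; apply: open_lcoset; exact: (open_normal_open oH).
Qed.

Lemma open_normal_closed_subgroup H : open_normal H -> is_closed_subgroup H.
Proof.
move=> oH; split; first exact: open_normal_closed.
- exact: (normal1 oH).
- exact: (normalM oH).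
- exact: (normalV oH).
Qed.

Lemma open_normalT : open_normal [set: G].
Proof. by split=> //; exact: openT. Qed.

Lemma open_normalI H K :
  open_normal H -> open_normal K -> open_normal (H `&` K).
Proof.
move=> oH oK; split; last first.
  by apply: openI; [exact: (open_normal_open oH)|exact: (open_normal_open oK)].
split=> [|g x [Hx Kx]]; last first.
  by split; [exact: (normalJ oH)|exact: (normalJ oK)].
split=> [|x y [Hx Kx] [Hy Ky]|x [Hx Kx]].
- by split; [exact: (normal1 oH)|exact: (normal1 oK)].
- by split; [exact: (normalM oH)|exact: (normalM oK)].
- by split; [exact: (normalV oH)|exact: (normalV oK)].
Qed.

(** The complements of finite unions of cosets are closed, directed and have empty intersection, so
    one of them is empty. *)
Lemma open_normal_finite_mod H : open_normal H -> finite_mod setT H.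
Proof.
move=> oH.
pose D := [set C | exists2 R : set G, finite_set R &
  C = ~` \bigcup_(r in R) lcoset r H].
have [|||||C [R finR ->] nC] :=
  @compact_directed _ (@profinite_compact G) D set0.
- exists setT; exists set0; first exact: finite_set0.
  by rewrite bigcup_set0 setC0.
- move=> _ [R _ ->]; apply: open_closedC; apply: bigcup_open => r _.
  by apply: open_lcoset; exact: (open_normal_open oH).
- exact: open0.
- move=> _ _ [R finR ->] [S finS ->].
  exists (~` \bigcup_(r in R `|` S) lcoset r H).
    by exists (R `|` S) => //; rewrite finite_setU.
  by rewrite bigcup_setU setCU.
- move=> x /(_ (~` \bigcup_(r in [set x]) lcoset r H)) nx.
  apply: nx; first by exists [set x] => //; exact: finite_set1.
  by exists x => //; exists 1; rewrite ?mulg1 //; exact: (normal1 oH).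
exists R; split=> // a _; apply: contrapT => na.
apply: (nC a) => -[r Rr [h Hh ra]].
by apply: na; exists r; rewrite // -ra mulKg.
Qed.

(* For [U] clopen, [{x | forall a b, a x b \in U <-> a b \in U}] is a normal
   subgroup contained in [U], and it is open by compactness. *)
Lemma open_normal_base (O : set G) : nbhs (1 : G) O ->
  exists2 H, open_normal H & H `<=` O.
Proof.
move=> nO.
have zG := totally_disconnected_zero_dimensional (@profinite_compact G)
  (@profinite_hausdorff G) (@profinite_totally_disconnected G).
have [U [U1 [oU cU]] UO] := zero_dimensional_cvg (@profinite_hausdorff G) zG
  (@profinite_compact G) nO.
pose H : set G := [set x | forall a b, U (a * x * b) <-> U (a * b)].
have nH : is_normal H.
  split=> [|g x Hx a b]; last first.
    by have := Hx (a * g^-1) (g * b); rewrite /conjg !mulgA mulgVK.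
  split=> [a b|x y Hx Hy a b|x Hx a b]; first by rewrite mulg1.
    by rewrite mulgA (Hy (a * x) b) Hx.
  by have := Hx (a * x^-1) b; rewrite mulgVK; tauto.
have H_nbhs : nbhs (1 : G) H.
  (* [U] and its complement are open, so the equivalence holds near each [(a, b, 1)]; compactness of
     the square of [G] makes the neighbourhood of [1] uniform. *)
  have /compact_near_coveringP/(_ G (nbhs 1)
    (fun x p => U (p.1 * x * p.2) <-> U (p.1 * p.2))) := compact_setX
    (@profinite_compact G) (@profinite_compact G).
move=> cov; apply: (filterS _ (cov _ _)) => [x Hx a b|[a b] _].
    exact: (Hx (a, b)).
  have cfst : continuous (fun q : (G * G) * G => q.1.1).
    by move=> q; apply: continuous_comp; exact: cvg_fst.
  have csnd : continuous (fun q : (G * G) * G => q.1.2).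
    by move=> q; apply: continuous_comp; [exact: cvg_fst|exact: cvg_snd].
  have c1 : continuous (fun q : (G * G) * G => q.1.1 * q.2 * q.1.2).
    by apply: mulg_cvg => //; apply: mulg_cvg => // q; exact: cvg_snd.
  have c2 : continuous (fun q : (G * G) * G => q.1.1 * q.1.2).
    exact: mulg_cvg.
  have same V : open V -> V (a * b) -> nbhs ((a, b), 1 : G)
      [set q | V (q.1.1 * q.2 * q.1.2) /\ V (q.1.1 * q.1.2)].
    move=> oV Vab.
    apply: filterI; [apply: (c1 (a, b, 1))|apply: (c2 (a, b, 1))];
      by apply: open_nbhs_nbhs; split=> //=; rewrite mulg1.
  have [Uab|nUab] := pselect (U (a * b)).
    by apply: filterS (same _ oU Uab) => q [].
  by apply: filterS (same _ (closed_openC cU) nUab) => q [].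
exists H; last first.
  by move=> x Hx; apply: UO; rewrite -(mulg1 x) -(mul1g x) Hx mulg1.
(* A subgroup that is a neighbourhood of [1] is open, by translation. *)
split=> //; rewrite openE => x Hx.
have cx : (fun y => x^-1 * y) @ x --> (1 : G).
  by rewrite -(mulVg x); exact: mulgl_continuous.
have nHx : nbhs x ((fun y => x^-1 * y) @^-1` H) by exact: cx _ H_nbhs.
by apply: filterS nHx => y /= Hy; have := normalM nH Hx Hy; rewrite mulVKg.
Qed.

Lemma open_normal_nbhs x (O : set G) : nbhs x O ->
  exists2 H, open_normal H & lcoset x H `<=` O.
Proof.
move=> xO; have [|H oH HO] := @open_normal_base ((fun y => x * y) @^-1` O).
  by apply: mulgl_continuous; rewrite mulg1.
by exists H => // _ [h /HO xh <-].
Qed.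

(* A hands-on Baire category argument in the space of all [nat -> G], with the
   boxes [{q | forall i, q i \in p i H}] for [H] open normal as a base. *)
Lemma wvalues_baire w (I : set nat) (F : nat -> set G) (a : nat -> G)
    (K : set G) :
  open_normal K -> (forall k, I k -> closed (F k)) ->
  wvalues G w `<=` \bigcup_(k in I) F k ->
  exists H p k, [/\ open_normal H, H `<=` K, forall i, K ((a i)^-1 * p i), I k &
    forall q, (forall i, H ((p i)^-1 * q i)) -> F k (weval q w)].
Proof.
move=> oK cF wF; apply: contrapT => nP.
pose box (s : (nat -> G) * set G) : set (nat -> G) :=
  [set q | forall i, s.2 ((s.1 i)^-1 * q i)].
pose good s := [/\ open_normal s.2, s.2 `<=` K & box (a, K) s.1].
(* One Baire step: the box is shrunk so that the values on it avoid [F k]. It is kept if [k] is not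
   in [I]. *)
have /choice[f fP] : forall ks : nat * ((nat -> G) * set G), exists s',
    good ks.2 -> [/\ good s', box s' `<=` box ks.2 &
      I ks.1 -> forall q, box s' q -> ~ F ks.1 (weval q w)].
  move=> [k [p H]] /=.
  have [[oH HK pa]|nH] := pselect (good (p, H)); last by exists (a, K) => /nH.
  have [Ik|nIk] := pselect (I k); last by exists (p, H) => gs; split.
  have [q pq nFq] : exists2 q, box (p, H) q & ~ F k (weval q w).
    apply: contrapT => nq; apply: nP; exists H, p, k; split=> // q pq.
    by apply: contrapT => nFq; apply: nq; exists q.
  have [|L oL qL] := @open_normal_nbhs (weval q w) (~` F k).
    by apply: open_nbhs_nbhs; split=> //; apply: closed_openC; exact: cF.
  exists (q, H `&` L) => _; split=> /= [|q' qq' i|_ q' qq'].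
  - split=> /= [|x [/HK]//|i]; first exact: open_normalI.
    by apply: (normal_div_trans oK (pa i)); exact/HK/pq.
  - by apply: (normal_div_trans oH (pq i)); have [] := qq' i.
  - apply: qL; exists ((weval q w)^-1 * weval q' w); last by rewrite mulVKg.
    by apply: (weval_normal_div _ oL) => i; have [] := qq' i.
pose s := fix s n := if n is m.+1 then f (m, s m) else (a, K).
have goods n : good (s n).
  elim: n => [|n IHn]; last by have [] := fP (n, s n) IHn.
  by split=> // i; rewrite /= mulVg; exact: (normal1 oK).
have boxs n m : (n <= m)%N -> box (s m) `<=` box (s n).
  move=> nm; rewrite -(subnK nm); elim: (_ - _)%N => [//|j IHj].
  rewrite addSn; have [_ sub _] := fP ((j + n)%N, s (j + n)%N) (goods _).
  exact: subset_trans sub IHj.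
(* The nested boxes have a common point, found by compactness in each coordinate separately. *)
have /choice[q sq] : forall i, exists x, forall n, (s n).2 (((s n).1 i)^-1 * x).
  move=> i; apply: contrapT => nx.
  pose D := [set C | exists n, C = lcoset ((s n).1 i) (s n).2].
  have [|||||_ [n ->]] := @compact_directed _ (@profinite_compact G) D set0.
  - by exists (lcoset (a i) K); exists 0%N.
  - move=> _ [n ->]; have [on _ _] := goods n.
    by apply: closed_lcoset; exact: open_normal_closed.
  - exact: open0.
  - move=> _ _ [n ->] [m ->]; pose k := maxn n m.
    exists (lcoset ((s k).1 i) (s k).2); first by exists k.
    have sub j : (j <= k)%N -> lcoset ((s k).1 i) (s k).2 `<=`
        lcoset ((s j).1 i) (s j).2.
      move=> jk; rewrite !lcoset_preimage => x /= kx.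
      (* Varying one coordinate only turns the inclusion of boxes into an inclusion of cosets. *)
      pose c i' := if i' == i then x else (s k).1 i'.
      have : box (s k) c.
        move=> i'; rewrite /c; case: eqP => [->//|_].
        by rewrite mulVg; have [[nn _] _ _] := goods k; exact: (normal1 nn).
      by move=> /(boxs _ _ jk)/(_ i); rewrite /c eqxx.
    by move=> x kx; split; apply: sub kx; rewrite ?leq_maxl ?leq_maxr.
  - move=> x Cx; apply: nx; exists x => n.
    have : lcoset ((s n).1 i) (s n).2 x by apply: Cx; exists n.
    by rewrite lcoset_preimage.
  - move=> /(_ ((s n).1 i)); apply; exists 1; rewrite ?mulg1 //.
    by have [[nn _] _ _] := goods n; exact: (normal1 nn).
have [|k Ik Fq] := wF (weval q w); first by exists q.
have [_ _ /(_ Ik)] := fP (k, s k) (goods k).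
by apply; [move=> i; exact: (sq i k.+1)|exact: Fq].
Qed.

End Profinite.

(** * Normal subgroups in the class *)

Lemma closed_subgroup_preimage (A G : topologicalGroupType) (f : A -> G)
    (fM : {morph f : x y / x * y}) (cf : continuous f) (L : closedSubgroup G) :
  is_closed_subgroup (f @^-1` L).
Proof.
have f1 : f 1 = 1 by apply: (mulgI (f 1)); rewrite -fM !mulg1.
have fV x : f x^-1 = (f x)^-1 by apply: (mulgI (f x)); rewrite -fM !mulgV.
have [cL L1 LM LV] := subgroupP L.
split=> [||x y|x] /=; rewrite ?f1 ?fM ?fV //; [|exact: LM|exact: LV].
by apply: closed_comp => // x _; exact: cf.
Qed.

Lemma closed_subgroupI (G : topologicalGroupType) (A B : closedSubgroup G) :
  is_closed_subgroup (A `&` B).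
Proof.
have [cA A1 AM AV] := subgroupP A; have [cB B1 BM BV] := subgroupP B.
split=> [||x y [? ?] [? ?]|x [? ?]]; first exact: closedI; split=> //.
- exact: AM.
- exact: BM.
- exact: AV.
- exact: BV.
Qed.

Lemma conjg_continuous (G : topologicalGroupType) (g : G) :
  continuous (fun x : G => x ^ g).
Proof.
apply: mulg_cvg; first exact: cst_continuous.
by apply: mulg_cvg; [move=> z; exact: cvg_id|exact: cst_continuous].
Qed.

(** [S] is the set of conjugators: an open normal subgroup for the relative core, the whole group
    for the normal core. *)
Lemma closed_subgroup_core (G : topologicalGroupType) (S : set G)
    (K : closedSubgroup G) :
  is_closed_subgroup [set x | forall g, S g -> subgroup_set K (x ^ g)].
Proof.
have [cK K1 KM KV] := subgroupP K.
split=> [|g _|x y Kx Ky g Sg|x Kx g Sg] /=.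
- have -> : [set x | forall g, S g -> subgroup_set K (x ^ g)] =
      \bigcap_(g in S) ((fun x => x ^ g) @^-1` K) by [].
  apply: closed_bigI => g _; apply: closed_comp => // x _.
  exact: conjg_continuous.
- by rewrite conj1g.
- by rewrite conjMg; apply: KM; [exact: Kx|exact: Ky].
- by rewrite conjVg; apply/KV/Kx.
Qed.

Section Product.
Variables (G : profiniteGroupType) (A B : closedSubgroup G).
Hypothesis AB : forall a b, subgroup_set A a -> subgroup_set B b ->
  subgroup_set B (b ^ a).

(** The product is closed as the image of a compact set, and a subgroup because [A] normalises
    [B]. *)
Lemma closed_subgroup_mul :
  is_closed_subgroup [set a * b | a in subgroup_set A & b in subgroup_set B].
Proof.
have [cA A1 AM AV] := subgroupP A; have [cB B1 BM BV] := subgroupP B.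
split=> [||_ _ [a Aa [b Bb <-]] [a' Aa' [b' Bb' <-]]|_ [a Aa [b Bb <-]]].
- apply: (compact_closed (@profinite_hausdorff G)).
  have -> : [set a * b | a in subgroup_set A & b in subgroup_set B] =
      (fun p : G * G => p.1 * p.2) @` (A `*` B).
    apply/seteqP; split=> [_ [a Aa [b Bb <-]]|_ [[a b] [/= Aa Bb] <-]].
      by exists (a, b).
    by exists a => //; exists b.
  apply: continuous_compact.
    by apply: continuous_subspaceT; exact: mulg_continuous.
  by apply: compact_setX; apply: (subclosed_compact _ (@profinite_compact G)).
- by exists 1 => //; exists 1; rewrite ?mulg1.
- exists (a * a'); first exact: AM.
  exists (b ^ a' * b'); first by apply: BM => //; exact: AB.
  by group_nf.
- exists a^-1; first exact: AV; exists (b^-1 ^ a^-1); last by group_nf.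
  by apply: AB; [exact: AV|exact: BV].
Qed.

End Product.

Section Class.
Variable C : profinite_class.
Hypotheses (C_subgroup : subgroup_closed C) (C_quotient : quotient_closed C).
Hypothesis C_product : normal_product_closed C.

(** The corestriction of [f] is a continuous bijection from a compact to a Hausdorff space, hence a
    homeomorphism and a [quotient_hom]. *)
Lemma class_embed (A G : profiniteGroupType) (f : A -> G)
    (L : closedSubgroup G) :
  {morph f : x y / x * y} -> continuous f -> injective f -> range f = L ->
  C A -> C (subgroup_profinite L).
Proof.
move=> fM cf finj fL.
have Lf a : f a \in (L : set G) by rewrite inE -fL; exists a.
pose f' a : subgroup_profinite L := exist _ (f a) (Lf a).
have cf' : continuous f' by exact: continuous_into_subgroup.
have f'onto x : exists a, f' a = x.
  have sub : subgroup_set L `<=` range f by rewrite fL.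
  by have [a _ fa] := sub _ (set_valP x); exists a; exact: val_inj.
have f'inj : injective f' by move=> a b /(congr1 val)/finj.
apply: (C_quotient (f := f')); split.
- by move=> a b; apply: val_inj; exact: fM.
- by apply/seteqP; split=> // x _; have [a <-] := f'onto x; exists a.
- move=> U; split=> [oU|oU]; first by apply: open_comp => // x _; exact: cf'.
  rewrite -(setCK U); apply: closed_openC.
  have -> : ~` U = f' @` (~` (f' @^-1` U)).
    apply/seteqP; split=> [x nUx|_ [a nUa <-] //].
    by have [a ax] := f'onto x; exists a; rewrite //= ax.
  apply: (compact_closed (@profinite_hausdorff _)).
  apply: continuous_compact; first exact: continuous_subspaceT.
  apply: (subclosed_compact _ (@profinite_compact A)) => //.
  exact: open_closedC.
Qed.

Section Sub.
Variable G : profiniteGroupType.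
Implicit Types (H M : set G) (A B K L N P : closedSubgroup G).

Lemma subgroup_valM K : {morph (val : subgroup_profinite K -> G) : x y / x * y}.
Proof. by []. Qed.

Definition trace_subgroup K L : closedSubgroup (subgroup_profinite K) :=
  ClosedSubgroup (closed_subgroup_preimage (@subgroup_valM K)
    (@subgroup_val_continuous G K) L).

Lemma val_trace_subgroup K L : subgroup_set L `<=` subgroup_set K ->
  val @` subgroup_set (trace_subgroup K L) = L.
Proof.
move=> LK; apply/seteqP; split=> [_ [x Lx <-] //|x Lx].
by exists (exist _ x (mem_set (LK _ Lx))).
Qed.

(** A subgroup of a subgroup and its image in [G] have different carrier types, and the class speaks
    of types. *)
Lemma class_val K (L : closedSubgroup (subgroup_profinite K)) L' :
  val @` subgroup_set L = L' ->
  C (subgroup_profinite L) -> C (subgroup_profinite L').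
Proof.
move=> LL'; pose f (x : subgroup_profinite L) : G := val (val x).
apply: (class_embed (f := f)) => //.
- move=> x; apply: continuous_comp; exact: subgroup_val_continuous.
- by move=> x y /val_inj/val_inj.
- rewrite -LL'; apply/seteqP; split=> [_ [x _ <-]|_ [x Lx <-]].
    by exists (val x) => //; exact: set_valP.
  by exists (exist _ x (mem_set Lx)).
Qed.

Lemma class_sub K L : subgroup_set L `<=` subgroup_set K ->
  C (subgroup_profinite K) -> C (subgroup_profinite L).
Proof.
by move=> LK CK; apply: class_val (val_trace_subgroup LK) _; exact: C_subgroup.
Qed.

Lemma class_trace_subgroup K L : subgroup_set L `<=` subgroup_set K ->
  C (subgroup_profinite L) -> C (subgroup_profinite (trace_subgroup K L)).
Proof.
move=> LK.
pose f (x : subgroup_profinite L) : subgroup_profinite K :=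
  exist _ (val x) (mem_set (LK _ (set_valP x))).
apply: (class_embed (f := f)).
- by move=> x y; exact: val_inj.
- by apply: continuous_into_subgroup; exact: subgroup_val_continuous.
- by move=> x y /(congr1 val) ?; exact: val_inj.
- apply/seteqP; split=> [_ [x _ <-]|x Lx]; first exact: (set_valP x).
  by exists (exist _ (val x) (mem_set Lx)) => //; exact: val_inj.
Qed.

Definition class_normal_in M A := [/\ C (subgroup_profinite A),
  subgroup_set A `<=` M &
  forall m x, M m -> subgroup_set A x -> subgroup_set A (x ^ m)].

(** [normal_product_closed] is applied inside the profinite group [K], where both factors become
    normal subgroups. *)
Lemma class_join2 K A B :
  class_normal_in K A -> class_normal_in K B -> exists P,
    [/\ class_normal_in K P, subgroup_set A `<=` P & subgroup_set B `<=` P].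
Proof.
move=> [CA AK AJ] [CB BK BJ].
have AB a b : subgroup_set A a -> subgroup_set B b -> subgroup_set B (b ^ a).
  by move=> /AK; exact: BJ.
have [cK K1 KM KV] := subgroupP K.
have A1 := closed_subgroup1 (subgroupP A).
have B1 := closed_subgroup1 (subgroupP B).
pose P := ClosedSubgroup (closed_subgroup_mul AB).
have PK : subgroup_set P `<=` K.
  by move=> _ [a /AK Ka [b /BK Kb <-]]; exact: KM.
exists P; split=> [|a Aa|b Bb]; last 2 first.
- by exists a => //; exists 1; rewrite ?mulg1.
- by exists 1 => //; exists b; rewrite ?mul1g.
split=> // [|m _ Km [a Aa [b Bb <-]]]; last first.
  rewrite conjMg; exists (a ^ m); first exact: AJ.
  by exists (b ^ m) => //; exact: BJ.
apply: class_val (val_trace_subgroup PK) _.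
pose F (i : 'I_2) :=
  if i == ord0 then trace_subgroup K A else trace_subgroup K B.
apply: (C_product (N := F)) => [i|i|].
- move=> g x; rewrite /F; case: ifP => _ Nx.
    by apply: (AJ (val g) (val x)) => //; exact: set_valP.
  by apply: (BJ (val g) (val x)) => //; exact: set_valP.
- by rewrite /F; case: ifP => _; apply: class_trace_subgroup.
- apply/seteqP; split=> [x [a Aa [b Bb abx]]|_ [x Fx <-]].
    pose x' (i : 'I_2) : subgroup_profinite K :=
      if i == ord0 then exist _ a (mem_set (AK _ Aa))
      else exist _ b (mem_set (BK _ Bb)).
    exists x'; first by move=> i; rewrite /F /x' /=; case: ifP.
    rewrite !big_ord_recl big_ord0 mulg1; apply: val_inj; exact: abx.
  rewrite !big_ord_recl big_ord0 mulg1.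
  exists (val (x ord0)); first exact: (Fx ord0).
  by exists (val (x (lift ord0 ord0))) => //; exact: (Fx (lift ord0 ord0)).
Qed.

Lemma class_join_seq (T : eqType) (s : seq T) (F : T -> closedSubgroup G) K A :
  class_normal_in K A -> (forall t, class_normal_in K (F t)) -> exists P,
    class_normal_in K P /\ forall t, t \in s -> subgroup_set (F t) `<=` P.
Proof.
move=> KA KF; elim: s => [|t s [P [KP sP]]]; first by exists A.
have [Q [KQ PQ tQ]] := class_join2 KP (KF t).
exists Q; split=> // t'; rewrite inE => /orP[/eqP -> //|/sP].
by move=> /subset_trans; apply.
Qed.

(* The conjugates of [A] are finitely many and normal in [H], so they lie in a
   common class subgroup [P] normal in [H]; [N] is the normal core of [P]. *)
Lemma class_normal_closure H A : open_normal H -> class_normal_in H A ->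
  exists N, [/\ C (subgroup_profinite N), normal_subgroup N &
    subgroup_set A `<=` N].
Proof.
move=> oH HA; have [CA AH AJ] := HA.
have sH := open_normal_closed_subgroup oH.
pose K := ClosedSubgroup sH.
have cJ g := closed_subgroup_preimage (fun x y => conjMg x y g^-1)
  (@conjg_continuous G g^-1) A.
pose F g := ClosedSubgroup (cJ g).
have KF g : class_normal_in K (F g).
  split=> [|x /= /AH|m x /= Hm Ax].
  - apply: (class_embed (f := fun x : subgroup_profinite A => val x ^ g)) CA.
    + by move=> x y; exact: conjMg.
    + move=> x; apply: (@continuous_comp (subgroup_profinite A) G G val
        (fun y : G => y ^ g)).
        exact: subgroup_val_continuous.
      exact: conjg_continuous.
    + by move=> x y /conjg_inj/val_inj.
    + apply/seteqP; split=> [_ [x _ <-] /=|x /= Ax].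
        by rewrite conjgK; exact: set_valP.
      by exists (exist _ (x ^ g^-1) (mem_set Ax)); rewrite //= conjgKV.
  - by move=> /(normalJ oH g); rewrite conjgKV.
  - by rewrite conjJg; apply: AJ => //; exact: (normalJ oH).
have [R [finR _ HR]] := open_normal_finite_mod oH.
have [s Rs] := (finite_seqP R).1 finR.
have [P [[CP _ PJ] sP]] := class_join_seq s (KF 1) KF.
have sN := closed_subgroup_core [set: G] P.
exists (ClosedSubgroup sN); split.
- by apply: class_sub CP => x /(_ 1 I); rewrite conjg1.
- by move=> g x Nx h _; rewrite -conjgM; exact: Nx.
(* Write [g = r * h] with [h] in [H]: the conjugate by [r] lies in [F r], hence in [P], which [h]
   preserves. *)
- move=> x Ax g _; have [//|r Rr rg] := HR g.
  rewrite -(mulVKg r g) conjgM; apply: PJ => //.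
  apply: (sP r); first by rewrite Rs in Rr.
  by rewrite /= conjgK.
Qed.

End Sub.

End Class.

(** * Killing values of the word modulo a normal subgroup in the class *)

(** A word involves finitely many variables, so finitely many vectors of coset representatives cover
    all its assignments. *)
Lemma coset_vectors (T : Type) (R : set T) (x0 : T) m : finite_set R ->
  exists2 V : set (nat -> T), finite_set V &
    forall g : nat -> T, (forall i, R (g i)) ->
      exists2 v, V v & forall i, (i < m)%N -> v i = g i.
Proof.
move=> finR; elim: m => [|m [V finV HV]].
  by exists [set fun=> x0]; [exact: finite_set1|move=> g _; exists (fun=> x0)].
exists [set (fun i => if i == m then r else v i) | v in V & r in R].
  exact: finite_image2.
move=> g gR; have [v Vv vg] := HV g gR.
exists (fun i => if i == m then g m else v i).
  by exists v => //; exists (g m).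
move=> i; rewrite ltnS leq_eqVlt; case: eqP => [-> //|_ /=]; exact: vg.
Qed.

(* By [weval_updM], a word that is constant modulo [N] on a box vanishes modulo
   [N] once at least one side [p i H] of the box is replaced by [H]. *)
Lemma weval_box (G : groupType) w (H N : set G) (p : nat -> G) (s : seq nat) :
  multilinear_commutator w -> is_normal H -> is_normal N ->
  {subset s <= wvars w} -> s != [::] ->
  (forall q, (forall i, H ((p i)^-1 * q i)) ->
     N ((weval p w)^-1 * weval q w)) ->
  forall q, (forall i, H ((if i \in s then 1 else p i)^-1 * q i)) ->
    N (weval q w).
Proof.
move=> mw nH nN sw s0 pN.
(* In [weval_updM] for [g], with [h = q i], the left side and [weval y w] are both values on the box
   of [r], hence congruent; the remaining factor is [weval q w]. *)
have step r i : i \in wvars w ->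
    (forall q, (forall j, H ((r j)^-1 * q j)) ->
       N ((weval r w)^-1 * weval q w)) ->
    forall q, (forall j, H ((upd r i 1 j)^-1 * q j)) -> N (weval q w).
  move=> iw rN q rq.
  pose g := upd q i (r i).
  have Hq : H (q i) by have := rq i; rewrite /upd eqxx invg1 mul1g.
  have rg j : H ((r j)^-1 * g j).
    have := rq j; rewrite /g /upd; case: eqP => [->|//] _.
    by rewrite mulVg; exact: (normal1 nH).
  have [y gy] := weval_updM g nH mw iw Hq.
  have -> : weval (upd g i (q i)) w = weval q w.
    by apply: weval_ext => j _; rewrite /g /upd; case: eqP => [->|].
  move=> wE; rewrite -(mulKg (weval y w) (weval q w)) -wE.
  have yN : N ((weval r w)^-1 * weval y w).
    by apply: rN => j; exact: (normal_div_trans nH (rg j) (gy j)).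
  apply: (normal_div_trans nN (normal_divC nN yN)); apply: rN => j.
  rewrite /upd; case: eqP => [->|_]; last exact: rg.
  by rewrite /g /upd eqxx mulKg.
case: s s0 sw => // i s _ sw.
(* Constancy on the box survives each replacement. The head [i] of [s] is kept for a last
   replacement, which gives vanishing. *)
have sub (t : seq nat) : {subset t <= wvars w} ->
    forall q, (forall j, H ((if j \in t then 1 else p j)^-1 * q j)) ->
    N ((weval (fun j => if j \in t then 1 else p j) w)^-1 * weval q w).
  elim: t => [//|j t IHt] tw.
  have jtN : forall q,
      (forall k, H ((if k \in j :: t then 1 else p k)^-1 * q k)) ->
      N (weval q w).
    move=> q Hq; apply: (step _ j _ (IHt _)).
    - by apply: tw; rewrite inE eqxx.
    - by move=> k kt; apply: tw; rewrite inE kt orbT.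
    - by move=> k; have := Hq k; rewrite inE /upd; case: eqP.
  move=> q Hq; apply: (normalM nN); last exact: jtN.
  by apply/(normalV nN)/jtN => k; rewrite mulVg; exact: (normal1 nH).
move=> q Hq; apply: (step _ i _ (sub s _)).
- by apply: sw; rewrite inE eqxx.
- by move=> k ks; apply: sw; rewrite inE ks orbT.
- by move=> k; have := Hq k; rewrite inE /upd; case: eqP.
Qed.

Lemma normal_subgroup_is_normal (G : topologicalGroupType)
    (N : closedSubgroup G) :
  normal_subgroup N -> is_normal (N : set G).
Proof. by have [_ N1 NM NV] := subgroupP N; split. Qed.

Section Class.
Variable C : profinite_class.
Hypotheses (C_subgroup : subgroup_closed C) (C_quotient : quotient_closed C).
Hypothesis C_product : normal_product_closed C.
Variables (w : gword) (G : profiniteGroupType).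
Hypothesis mw : multilinear_commutator w.

(** No relation links the two: [H] will be shrunk and [N] enlarged. *)
Definition class_pair (H : set G) (N : closedSubgroup G) :=
  [/\ open_normal H, normal_subgroup N & C (subgroup_profinite N)].

Lemma class_pair_join H H' N N' :
  class_pair H N -> class_pair H' N' -> exists M,
  [/\ class_pair (H `&` H') M, subgroup_set N `<=` M & subgroup_set N' `<=` M].
Proof.
move=> [oH nN CN] [oH' nN' CN'].
have cT : is_closed_subgroup [set: G] by split=> //; exact: closedT.
have [|| M [[CM _ MJ] NM N'M]] := class_join2 C_quotient C_product
    (A := N) (B := N') (K := ClosedSubgroup cT).
- by split=> // m x _; exact: nN.
- by split=> // m x _; exact: nN'.
exists M; split=> //; split=> //; first exact: open_normalI.
by move=> g x; exact: MJ.
Qed.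

(** Finitely many monotone requirements are met at once by intersecting the [H] and joining the
    [N]. *)
Lemma class_pair_seq (T : eqType) (s : seq T)
    (Q : T -> set G -> closedSubgroup G -> Prop) :
  (forall t (H H' : set G) (N N' : closedSubgroup G),
     H' `<=` H -> subgroup_set N `<=` N' -> Q t H N -> Q t H' N') ->
  forall H0 N0, class_pair H0 N0 ->
  (forall t, t \in s -> exists H N, class_pair H N /\ Q t H N) ->
  exists H N, [/\ class_pair H N, H `<=` H0, subgroup_set N0 `<=` N &
    forall t, t \in s -> Q t H N].
Proof.
move=> Qmono H0 N0 g0; elim: s => [|t s IHs] sQ; first by exists H0, N0; split.
have [|H [N [gHN HH0 N0N sHN]]] := IHs.
  by move=> t' t's; apply: sQ; rewrite inE t's orbT.
have [|H' [N' [gHN' tHN']]] := sQ t; first by rewrite inE eqxx.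
have [M [gM NM N'M]] := class_pair_join gHN gHN'.
exists (H `&` H'), M; split=> //.
- by move=> x [/HH0].
- by move=> x /N0N/NM.
- move=> t'; rewrite inE => /orP[/eqP ->|/sHN].
    by apply: Qmono tHN' => // x [].
  by apply: Qmono => // x [].
Qed.

Variables (I : set nat) (t : nat -> G) (K : nat -> closedSubgroup G).
Hypothesis CK : forall i, I i -> C (subgroup_profinite (K i)).
Hypothesis wK : wvalues G w `<=` \bigcup_(i in I) lcoset (t i) (K i).

(* The quotients of values of [w] on the box lie in [H] and in the [H]-core of
   [K k]: conjugation by [H] preserves the box. *)
Lemma constant_on_box (H0 : set G) (a : nat -> G) : open_normal H0 ->
  exists H N p, [/\ class_pair H N, H `<=` H0, forall i, H0 ((a i)^-1 * p i) &
    forall q, (forall i, H ((p i)^-1 * q i)) ->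
      subgroup_set N ((weval p w)^-1 * weval q w)].
Proof.
move=> oH0.
have clK i : I i -> closed (lcoset (t i) (K i)).
  by move=> _; exact: closed_lcoset (closed_subgroup_closed (subgroupP (K i))).
have [H [p [k [oH HH0 ap Ik pK]]]] := wvalues_baire a oH0 clK wK.
have sH := open_normal_closed_subgroup oH.
pose A := ClosedSubgroup (closed_subgroupI
  (ClosedSubgroup (closed_subgroup_core H (K k))) (ClosedSubgroup sH)).
have HA : class_normal_in C H A.
  split=> [|x []//|m x Hm [Kx Hx]].
  - apply: (class_sub C_subgroup C_quotient (K := K k)) (CK Ik).
    by move=> x [/(_ 1 (normal1 oH))]; rewrite conjg1.
  - split; last exact: (normalJ oH).
    by move=> h Hh; rewrite -conjgM; apply: Kx; exact: (normalM oH).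
have [N [CN nN AN]] :=
  class_normal_closure C_subgroup C_quotient C_product oH HA.
exists H, N, p; split=> // q pq; apply: AN.
split; last exact: weval_normal_div oH pq.
move=> h Hh; rewrite conjMg conjVg -!wevalJ.
have [|x Kx <-] := pK (fun i => p i ^ h).
  by move=> i; apply: (normal_divJ oH Hh); rewrite mulVg; exact: (normal1 oH).
have [|y Ky <-] := pK (fun i => q i ^ h).
  by move=> i; apply: (normal_divJ oH Hh).
rewrite invgM mulgA mulgVK.
have [_ _ KM KV] := subgroupP (K k); apply: KM => //; exact: KV.
Qed.

(* Induction on the number of free positions. On each coset of [H1] some smaller
   box makes [w] vanish, and by the induction hypothesis and [weval_congr] the
   value of [w] depends only on the cosets of the entries in free positions. *)
Lemma vanishing_on_positions (J : pred nat) : has (predC J) (wvars w) ->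
  exists H N, class_pair H N /\
    forall c, (forall j, j \in wvars w -> ~~ J j -> H (c j)) ->
      subgroup_set N (weval c w).
Proof.
have [n] := ubnP (count J (undup (wvars w))); elim: n J => // n IHn J Jn Jw.
have [H0 [N0 [_ [g0 _ _ _]]]] := constant_on_box (fun=> 1) (open_normalT G).
(* The induction hypothesis for [J] without [j]. *)
pose P j H (N : closedSubgroup G) :=
  forall c : nat -> G,
    (forall i, i \in wvars w -> ~~ (J i && (i != j)) -> H (c i)) ->
    subgroup_set N (weval c w).
have [|j|H1 [N1 [g1 _ _ Q1]]] :=
  class_pair_seq (s := [seq j <- wvars w | J j]) (Q := P) _ g0.
- move=> j H H' N N' HH' NN' jHN c cH; apply/NN'/jHN => i iw iJ.
  exact/HH'/cH.
- rewrite mem_filter => /andP[Jj jw]; apply: (IHn [pred i | J i && (i != j)]).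
    apply: leq_trans (_ : count J (undup (wvars w)) <= n)%N; last by [].
    have /uniq_leq_size :
        uniq (j :: [seq i <- undup (wvars w) | J i && (i != j)]).
      by rewrite /= mem_filter eqxx andbF filter_uniq ?undup_uniq.
    move=> /(_ [seq i <- undup (wvars w) | J i]).
    rewrite /= !size_filter; apply.
    move=> i; rewrite inE => /orP[/eqP ->|].
      by rewrite mem_filter Jj mem_undup.
    by rewrite !mem_filter => /andP[/andP[-> _]].
  by case/hasP: Jw => i iw /= iJ; apply/hasP; exists i; rewrite //= (negPf iJ).
have [o1 nN1 _] := g1.
have [R [finR _ HR]] := open_normal_finite_mod o1.
have [m wm] : exists m, forall i, i \in wvars w -> (i < m)%N.
  exists (\max_(i <- wvars w) i).+1 => i iw.
  by rewrite ltnS; exact: leq_bigmax_seq.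
have [V finV HV] := coset_vectors 1 m finR.
have [s Vs] := (finite_seqP V).1 finV.
(* [v] fixes the cosets of [H1] that contain the free entries; finitely many [v] suffice. *)
pose Q (v : nat -> G) H (N : closedSubgroup G) :=
  forall c : nat -> G,
    (forall i, i \in wvars w ->
       if J i then H1 ((v i)^-1 * c i) else H (c i)) ->
    subgroup_set N (weval c w).
have [|v _|H [N [gHN HH1 _ sHN]]] := class_pair_seq (s := s) (Q := Q) _ g1;
    last first.
  exists H, N; split=> // c cH.
  have /choice[r rP] : forall i, exists r, R r /\ H1 (r^-1 * c i).
    by move=> i; have [//|r] := HR (c i); exists r.
  have [v Vv vr] := HV r (fun i => (rP i).1).
  apply: (sHN v); first by rewrite Vs in Vv.
  move=> i iw; case: ifPn => Ji; last exact: cH.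
  by rewrite vr ?wm //; have [] := rP i.
(* The base point is [1] outside [J], so that [p] lies in [H1] there, as [weval_congr] requires. *)
- have [H [N [p [gHN HH1 vp pN]]]] :=
    constant_on_box (fun i => if J i then v i else 1) o1.
  have [M [gM N1M NM]] := class_pair_join g1 gHN.
  have [_ nN _] := gHN; have [oH _ _] := gHN.
  exists (H1 `&` H), M; split=> // c cH.
  (* [b] agrees with [c] on the variables of [w], and [b'] moves the free entries to [p] within
     their cosets of [H1]. This keeps the value modulo [M], and [weval_box] applies to [b']. *)
  pose b i := if i \in wvars w then c i else p i.
  pose b' i := if J i then p i else b i.
  have -> : weval c w = weval b w by apply: weval_ext => i iw; rewrite /b iw.
  have nM : is_normal (M : set G).
    by apply: normal_subgroup_is_normal; case: gM.
  have bb' : subgroup_set M ((weval b w)^-1 * weval b' w).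
    apply: (weval_congr mw (H := H1) (I := J)) => //.
    + exact: (open_normal_normal o1).
    + move=> i d iw Ji Hdi Hd; apply: N1M; apply: (Q1 i).
        by rewrite mem_filter Ji.
      move=> j jw; rewrite negb_and negbK => /orP[/Hd //|/eqP ->//].
    + move=> j Jj; rewrite /b' /b Jj; case: ifP => jw.
        have := cH _ jw; have := vp j; rewrite Jj => pj cj.
        by apply: (normal_div_trans o1 (normal_divC o1 cj)).
      by rewrite mulVg; exact: (normal1 o1).
    + move=> j Jj; rewrite /b' (negPf Jj); split=> //.
      rewrite /b; case: ifP => jw.
        by have := cH _ jw; rewrite (negPf Jj) => -[].
      by have := vp j; rewrite (negPf Jj) invg1 mul1g.
  apply/(normal_divE nM bb')/NM.
  pose z := [seq j <- wvars w | ~~ J j].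
  apply: (weval_box (s := z) mw oH (normal_subgroup_is_normal nN) _ _ pN).
  + by move=> j; rewrite mem_filter => /andP[].
  + by rewrite -size_eq0 size_filter -lt0n -has_count.
  + move=> j; rewrite mem_filter /b' /b; case: (boolP (J j)) => Jj /=.
      by rewrite mulVg; exact: (normal1 oH).
    case: ifP => jw; last by rewrite mulVg; exact: (normal1 oH).
    by rewrite invg1 mul1g; have := cH _ jw; rewrite (negPf Jj) => -[].
- move=> v H H' N N' HH' NN' vHN c cH; apply/NN'/vHN => i iw.
  by have := cH i iw; case: ifP => // _; exact: HH'.
Qed.

(** For each variable [j], all positions except [j] are taken as free. *)
Lemma vanishing : exists H N, class_pair H N /\
  forall (c : nat -> G) i, i \in wvars w -> H (c i) ->
    subgroup_set N (weval c w).
Proof.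
have [H0 [N0 [_ [g0 _ _ _]]]] := constant_on_box (fun=> 1) (open_normalT G).
pose Q j (H : set G) (N : closedSubgroup G) :=
  forall c : nat -> G, H (c j) -> subgroup_set N (weval c w).
have [|j jw|H [N [gHN _ _ Qj]]] := class_pair_seq (s := wvars w) (Q := Q) _ g0.
- by move=> j H H' N N' HH' NN' jHN c /HH'/jHN/NN'.
- have [|H [N [gHN HN]]] := @vanishing_on_positions [pred i | i != j].
    by apply/hasP; exists j; rewrite //= eqxx.
  exists H, N; split=> // c Hc; apply: HN => i _ /=; rewrite negbK => /eqP ->.
  exact: Hc.
- by exists H, N; split=> // c i iw; exact: Qj.
Qed.

Lemma verbal_virtually : virtually C (subgroup_profinite (verbal_subgroup G w)).
Proof.
have [H [N [[oH nN CN] HN]]] := vanishing.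
set W := verbal_subgroup G w.
have [Q [pi [P [piP finP [P1 PM PV] wP]]]] := finite_verbal_quotient
  (verbal_finite mw) oH (open_normal_finite_mod oH)
  (normal_subgroup_is_normal nN) HN.
(* A finite union of cosets of [N] is closed, so this subgroup contains the closed subgroup [W] and
   not only the values. *)
have sPP : is_closed_subgroup (pi @^-1` P).
  split=> //; have -> : pi @^-1` P = \bigcup_(q in P) (pi @^-1` [set q]).
    by apply/seteqP; split=> [x Px|x [q Pq /= ->]//]; exists (pi x).
  apply: closed_bigcup => // q _.
  have [[x <-]|nx] := pselect (exists x, pi x = q); last first.
    suff -> : pi @^-1` [set q] = set0 by exact: closed0.
    by rewrite -subset0 => x /= xq; apply: nx; exists x.
  suff -> : pi @^-1` [set pi x] = lcoset x N.
    by apply: closed_lcoset; exact: closed_subgroup_closed (subgroupP N).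
  by rewrite lcoset_preimage; apply/seteqP; split=> y /=; [move=> /esym|];
    move=> /piP.
have WP : subgroup_set W `<=` pi @^-1` P.
  exact: smallest_sub.
pose NW := ClosedSubgroup (closed_subgroupI N W).
exists (trace_subgroup W NW); split.
- by move=> g x [Nx Wx]; split; [exact: (nN (val g) (val x))|exact: set_valP].
(* The cosets are fibres of [pi] on [W], and [pi] maps [W] into the finite set [P]. *)
- apply: (sub_finite_set _ (finite_image
    (fun q => [set x : subgroup_profinite W | pi (val x) = q]) finP)).
  move=> _ [t' _ <-]; exists (pi (val t')); first by apply/WP/set_valP.
  rewrite lcoset_preimage; apply/seteqP; split=> x /=.
    by move=> /esym/piP Nx; split=> //; exact: set_valP (t'^-1 * x).
  by move=> [Nx _]; apply/esym/piP.
- apply: (class_trace_subgroup C_quotient); first by move=> x [].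
  by apply: (class_sub C_subgroup C_quotient) CN => x [].
Qed.

End Class.

Theorem theorem1p1 (C : profinite_class)
    (C_subgroup : subgroup_closed C)
    (C_quotient : quotient_closed C)
    (C_product : normal_product_closed C)
    (w : gword) (w_mlc : multilinear_commutator w)
    (G : profiniteGroupType) :
  virtually C (subgroup_profinite (verbal_subgroup G w)) <->
  exists (I : set nat) (t : nat -> G) (H : nat -> closedSubgroup G),
    (forall i, I i -> C (subgroup_profinite (H i))) /\
    wvalues G w `<=` \bigcup_(i in I) lcoset (t i) (subgroup_set (H i)).
Proof.
split=> [[N [nN finN CN]]|[I [t [K [CK wK]]]]]; last first.
  exact: verbal_virtually CK wK.
set W := verbal_subgroup G w in N nN finN CN.
have sL : is_closed_subgroup (val @` (N : set (subgroup_profinite W)) : set G).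
  have [cN N1 NM NV] := subgroupP N; split.
  - apply: (compact_closed (@profinite_hausdorff G)); apply: continuous_compact.
      exact/continuous_subspaceT/subgroup_val_continuous.
    exact: (subclosed_compact cN (@profinite_compact (subgroup_profinite W))).
  - by exists 1.
  - by move=> _ _ [x Nx <-] [y Ny <-]; exists (x * y) => //; exact: NM.
  - by move=> _ [x Nx <-]; exists x^-1 => //; exact: NV.
pose L := ClosedSubgroup sL.
have CL : C (subgroup_profinite L) by apply: (class_val C_quotient) CN.
have [s Ns] := (finite_seqP _).1 finN.
(* [s] lists the cosets of [N] in [W]; [f] picks representatives, with default [1] beyond the
   list. *)
have /choice[f fN] : forall k, exists x : subgroup_profinite W,
    (k < size s)%N -> nth set0 s k = lcoset x N.
  move=> k; have [ks|_] := ltnP k (size s); last by exists 1.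
  have : [set` s] (nth set0 s k) by exact: mem_nth.
  by rewrite -Ns => -[x _ <-]; exists x.
exists [set k | (k < size s)%N], (val \o f), (fun=> L); split=> // x wx.
have Wx : subgroup_set W x by apply: sub_gen_smallest.
pose y : subgroup_profinite W := exist _ x (mem_set Wx).
have ys : lcoset y N \in s.
  by have : [set` s] (lcoset y N) by rewrite -Ns; exists y.
exists (index (lcoset y N) s); first by rewrite /= index_mem.
have : lcoset y N y.
  by exists 1; rewrite ?mulg1 //; exact: closed_subgroup1 (subgroupP N).
rewrite -{1}(nth_index set0 ys) fN ?index_mem // => -[n Nn fy].
exists (val n); first by exists n.
exact: (congr1 val fy).
Qed.
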